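(* Let $V$ be a vertex operator algebra of CFT-type with $V_1\neq0$, $\mathcal H$ a subspace of a Cartan subalgebra of $V_1$ and $\alpha\in\mathcal H$. Let $\rho=(\alpha,1,\frac{\langle\alpha,\alpha\rangle}2)$, $J=\mathrm{Comm}(M(\rho),V\otimes V_{\Pi_{1,1}})$, and assume $\mathrm{Comm}(J,V\otimes V_{\Pi_{1,1}})=V_{\mathbb ZN\rho}$ with $N\ne0$. If $\langle\alpha,\alpha\rangle=\frac{2K}{N}$ (with $K$ a nonzero integer), then $V^{[N\alpha/K]}\cong V^{[\alpha]}$.
   Context: For $v\in V$ write $Y(v,z)=\sum_n v(n)z^{-n-1}$ (also $v_n=v(n)$). $V_1$ carries the form $u(1)v=\langle u,v\rangle\mathbf 1$. $\mathrm{Comm}(W,V)=\{v\in V: u(m)v=0\ \forall u\in W,\,m\ge 0\}$; $M(\rho)$ is the subVA generated by $\rho$. $\Pi_{1,1}=\mathbb Zr+\mathbb Zq$ with $\langle r,r\rangle=\langle q,q\rangle=0$, $\langle r,q\rangle=-1$; $V_{\Pi_{1,1}}$ is its lattice vertex algebra; an element $\beta+ar+bq$ of $\mathcal H\oplus\mathbb C\Pi_{1,1}\subseteq(V\otimes V_{\Pi_{1,1}})_1$ is written $(\beta,a,b)$. Definition of $V^{[\alpha]}$: with $\rho=(\alpha,1,\frac{\langle\alpha,\alpha\rangle}{2})$ (an isotropic element), $J=\mathrm{Comm}(M(\rho),V\otimes V_{\Pi_{1,1}})$ and $\mathrm{Comm}(J,V\otimes V_{\Pi_{1,1}})=V_{\mathbb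 ZN\rho}=\bigoplus_{n\in\mathbb Z}M(\rho)\otimes e^{nN\rho}$, let $P=\sum_{j\ge1}\rho(-j)J+(\mathbf 1-e^{N\rho})_{-1}J$, which is a proper ideal of $J$; then $V^{[\alpha]}=J/P$. In $V^{[N\alpha/K]}$ the same construction is applied to the element $N\alpha/K$ in place of $\alpha$. *)

(* Defs.v *)
From HB Require Import structures.
From mathcomp Require Import all_boot all_order all_algebra.
From mathcomp Require Import ring_quotient.
From mathcomp Require Import zify.
From mathcomp Require Import boolp classical_sets fsbigop.

Set Implicit Arguments.
Unset Strict Implicit.
Unset Printing Implicit Defensive.

Import Order.TTheory GRing.Theory Num.Theory.
Local Open Scope classical_set_scope.
Local Open Scope ring_scope.

Definition binz (F : numFieldType) (m : int) (i : nat) : F :=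
  (\prod_(j < i) (m%:~R - j%:R)) / (i`!)%:R.

Reserved Notation "u *_[ n ] v" (at level 40, n at level 200, left associativity,
  format "u  *_[ n ]  v").

(* [nprod u n v] is u(n)v, where Y(u,z) = \sum_n u(n) z^(-n-1).  The sums in
   the Borcherds identity are finitely supported by truncation, so that the
   junk value of [\sum_(i \in A)] on infinite supports is never used. *)
HB.mixin Record isVertexAlgebra (F : numFieldType) V of GRing.Lmodule F V := {
  vac : V;
  nprod : V -> int -> V -> V;
  nprod_linearl : forall n v, linear (fun u => nprod u n v);
  nprod_linearr : forall u n, linear (nprod u n);
  nprod_trunc : forall u v, exists B : int, forall n, B <= n -> nprod u n v = 0;
  vac_nprod : forall n v, nprod vac n v = if n == -1 then v else 0;
  nprod_vac : forall v n, 0 <= n -> nprod v n vac = 0;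
  nprod_vacN1 : forall v, nprod v (-1) vac = v;
  borcherds : forall u v w (m n k : int),
    \sum_(i \in [set: nat])
      binz F m i *: nprod (nprod u (n + i%:Z) v) (m + k - i%:Z) w
    = \sum_(i \in [set: nat]) ((-1) ^+ i * binz F n i) *:
        (nprod u (m + n - i%:Z) (nprod v (k + i%:Z) w)
         - (-1) ^ n *: nprod v (n + k - i%:Z) (nprod u (m + i%:Z) w))
}.

#[short(type="vertexAlgType")]
HB.structure Definition VertexAlgebra (F : numFieldType) :=
  {V of GRing.Lmodule F V & isVertexAlgebra F V}.

Notation "u *_[ n ] v" := (nprod u n%R v) : ring_scope.

Section ModeTheory.
Variables (F : numFieldType) (V : vertexAlgType F).
Implicit Types u v w : V.

HB.instance Definition _ u n :=
  GRing.isLinear.Build F V V *:%R (nprod u n) (nprod_linearr u n).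

Definition nprodl n v u := u *_[n] v.
HB.instance Definition _ n v :=
  GRing.isLinear.Build F V V *:%R (nprodl n v) (nprod_linearl n v).

Lemma nprod0l n v : 0 *_[n] v = 0. Proof. exact: (linear0 (nprodl n v)). Qed.
Lemma nprodDl n v u w : (u + w) *_[n] v = u *_[n] v + w *_[n] v.
Proof. exact: (linearD (nprodl n v)). Qed.
Lemma nprodBl n v u w : (u - w) *_[n] v = u *_[n] v - w *_[n] v.
Proof. exact: (linearB (nprodl n v)). Qed.
Lemma nprodZl n v a u : (a *: u) *_[n] v = a *: (u *_[n] v).
Proof. exact: (linearZZ (nprodl n v)). Qed.
Lemma nprod_suml n v I (r : seq I) P (E : I -> V) :
  (\sum_(i <- r | P i) E i) *_[n] v = \sum_(i <- r | P i) (E i *_[n] v).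
Proof. exact: (linear_sum (nprodl n v)). Qed.

Lemma nprodDr n u v w : u *_[n] (v + w) = u *_[n] v + u *_[n] w.
Proof. exact: linearD. Qed.
Lemma nprodBr n u v w : u *_[n] (v - w) = u *_[n] v - u *_[n] w.
Proof. exact: linearB. Qed.
Lemma nprod_sumr n u I (r : seq I) P (E : I -> V) :
  u *_[n] (\sum_(i <- r | P i) E i) = \sum_(i <- r | P i) (u *_[n] E i).
Proof. exact: linear_sum. Qed.

End ModeTheory.

Section Morphisms.
Variables (F : numFieldType) (V W : vertexAlgType F).

Definition va_morphism (f : V -> W) : Prop :=
  [/\ linear f, f vac = vac & forall u n v, f (u *_[n] v) = f u *_[n] f v].

Definition va_isomorphic : Prop := exists f : V -> W, va_morphism f /\ bijective f.

End Morphisms.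

Section Subalgebras.
Variables (F : numFieldType) (V : vertexAlgType F).
Implicit Types S A P : set V.

Definition subspace S : Prop :=
  S 0 /\ forall (a : F) u v, S u -> S v -> S (a *: u + v).

Definition is_subva S : Prop :=
  [/\ subspace S, S vac & forall u n v, S u -> S v -> S (u *_[n] v)].

Definition generated_subva A : set V :=
  [set v | forall S, is_subva S -> A `<=` S -> S v].

Definition Comm A : set V :=
  [set v | forall u, A u -> forall m : int, 0 <= m -> u *_[m] v = 0].

Definition is_ideal S P : Prop :=
  [/\ P `<=` S, subspace P,
      forall u n v, S u -> P v -> P (u *_[n] v)
    & forall u n v, P u -> S v -> P (u *_[n] v)].

Record subva := SubVA { subva_set : set V; subvaP : is_subva subva_set }.
Record ideal (S : subva) :=
  Ideal { ideal_set : set V; idealP : is_ideal (subva_set S) ideal_set }.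

End Subalgebras.

Section SubQuotient.
Variables (F : numFieldType) (V : vertexAlgType F) (S : subva V).

Definition subva_pred : {pred V} := fun x => `[< subva_set S x >].

Lemma subva_submod_closed : submod_closed subva_pred.
Proof.
have [[S0 SL] _ _] := subvaP S; split; first exact/asboolP.
by move=> a u v /asboolP Su /asboolP Sv; apply/asboolP/SL.
Qed.
HB.instance Definition _ :=
  GRing.isSubmodClosed.Build F V subva_pred subva_submod_closed.

Definition subva_type := {x : V | x \in subva_pred}.
HB.instance Definition _ := SubChoice.on subva_type.
HB.instance Definition _ := [SubChoice_isSubLmodule of subva_type by <:].

Lemma subva_typeP (x : subva_type) : subva_set S (val x).
Proof. exact/asboolP/(valP x). Qed.

Lemma subva_valZ a (u : subva_type) : val (a *: u) = a *: val u.
Proof. by []. Qed.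

Lemma subva_valB (u v : subva_type) : val (u - v) = val u - val v.
Proof. by []. Qed.

Lemma subva_val_sum n (E : nat -> subva_type) :
  val (\sum_(i < n) E i) = \sum_(i < n) val (E i).
Proof. exact: (raddf_sum (\val : {additive subva_type -> V})). Qed.

Definition in_subva x (Sx : subva_set S x) : subva_type :=
  exist (fun x => x \in subva_pred) x (asboolT Sx).

Definition subva_vac : subva_type :=
  let: And3 _ H _ := subvaP S in in_subva H.

Lemma val_subva_vac : val subva_vac = vac.
Proof. by rewrite /subva_vac; case: (subvaP S). Qed.

Lemma subva_nprod_subproof (u : subva_type) n (v : subva_type) :
  subva_set S (val u *_[n] val v).
Proof. have [_ _ H] := subvaP S; apply: H; exact: subva_typeP. Qed.

Definition subva_nprod u n v := in_subva (subva_nprod_subproof u n v).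

Lemma val_nprod u n v : val (subva_nprod u n v) = val u *_[n] val v.
Proof. by []. Qed.

End SubQuotient.

Section FiniteSums.
Variables (M : nmodType) (E : nat -> M) (B : nat).

Lemma fsum_natE : (forall i, (B <= i)%N -> E i = 0) ->
  \sum_(i \in [set: nat]) E i = \sum_(i < B) E i.
Proof.
move=> EB; rewrite fsbig_ord; apply/esym/fsbig_widen => //= i [_ /negP].
by rewrite -leqNgt => /EB.
Qed.

End FiniteSums.

Section Quotient.
Variables (F : numFieldType) (V : vertexAlgType F) (S : subva V) (I : ideal S).
Implicit Types u v w : subva_type S.

Definition ideal_pred : {pred subva_type S} := fun x => `[< ideal_set I (val x) >].

Lemma ideal_zmod_closed : zmod_closed ideal_pred.
Proof.
have [_ [I0 IL] _ _] := idealP I; split; first exact/asboolP.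
move=> u v /asboolP Iu /asboolP Iv; apply/asboolP.
by rewrite subva_valB addrC -scaleN1r; apply: IL.
Qed.
HB.instance Definition _ :=
  GRing.isZmodClosed.Build (subva_type S) ideal_pred ideal_zmod_closed.

Definition quotVA := Quotient.quot ideal_pred.
HB.instance Definition _ := GRing.Zmodule.on quotVA.

Definition qpi (u : subva_type S) : quotVA := \pi_quotVA%qT u.

Lemma qpiP u v : qpi u = qpi v <-> ideal_set I (val u - val v).
Proof.
rewrite -subva_valB; split=> [/eqP|H]; last apply/eqP.
  by rewrite /qpi -(Quotient.idealrBE ideal_pred) => /asboolP.
by rewrite /qpi -(Quotient.idealrBE ideal_pred); apply/asboolP.
Qed.

Lemma qpi_repr (x : quotVA) : qpi (repr x) = x. Proof. exact: reprK. Qed.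

Lemma qpiB : zmod_morphism qpi. Proof. exact: pi_is_zmod_morphism. Qed.
HB.instance Definition _ :=
  GRing.isZmodMorphism.Build (subva_type S) quotVA qpi qpiB.

Definition quot_scale (a : F) (x : quotVA) := qpi (a *: repr x).

Lemma ideal_setZ (a : F) (u : V) : ideal_set I u -> ideal_set I (a *: u).
Proof.
have [_ [I0 IL] _ _] := idealP I.
by move=> Iu; rewrite -[_ *: u]addr0; apply: IL.
Qed.

Lemma ideal_setD (u v : V) : ideal_set I u -> ideal_set I v -> ideal_set I (u + v).
Proof.
have [_ [I0 IL] _ _] := idealP I.
by move=> Iu; rewrite -[u]scale1r; apply: IL.
Qed.

Lemma qpiZ a u : qpi (a *: u) = quot_scale a (qpi u).
Proof.
apply/qpiP; rewrite -subva_valB -scalerBr subva_valZ; apply: ideal_setZ.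
by rewrite subva_valB; apply/qpiP; rewrite qpi_repr.
Qed.

Lemma quot_scaleA a b x : quot_scale a (quot_scale b x) = quot_scale (a * b) x.
Proof. by rewrite -(qpi_repr x) -!qpiZ scalerA. Qed.
Lemma quot_scale1 : left_id 1 quot_scale.
Proof. by move=> x; rewrite -(qpi_repr x) -!qpiZ scale1r. Qed.
Lemma quot_scaleDr : right_distributive quot_scale +%R.
Proof.
move=> a x y; rewrite -(qpi_repr x) -(qpi_repr y).
by rewrite -raddfD -!qpiZ scalerDr raddfD.
Qed.
Lemma quot_scaleDl x : {morph quot_scale^~ x : a b / a + b}.
Proof.
by move=> a b; rewrite -(qpi_repr x) -!qpiZ scalerDl raddfD.
Qed.
HB.instance Definition _ := GRing.Zmodule_isLmodule.Build F quotVA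
  quot_scaleA quot_scale1 quot_scaleDr quot_scaleDl.

Lemma qpi_scalable : scalable qpi. Proof. by move=> a u; rewrite qpiZ. Qed.
HB.instance Definition _ :=
  GRing.isScalable.Build F (subva_type S) quotVA *:%R qpi qpi_scalable.

Definition quot_nprod (x : quotVA) n (y : quotVA) := qpi (subva_nprod (repr x) n (repr y)).

Lemma qpi_nprod u n v : qpi (subva_nprod u n v) = quot_nprod (qpi u) n (qpi v).
Proof.
have [_ _ IR IL] := idealP I; apply/qpiP; rewrite !val_nprod.
set u' := repr _; set v' := repr _.
have Iu : ideal_set I (val u - val u') by apply/qpiP; rewrite qpi_repr.
have Iv : ideal_set I (val v - val v') by apply/qpiP; rewrite qpi_repr.
rewrite -(subrK (val u' *_[n] val v) (val u *_[n] val v)) -addrA -nprodBl.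
rewrite -[X in _ + X]linearB; apply: ideal_setD.
  by apply: IL => //; exact: subva_typeP.
by apply: IR => //; exact: subva_typeP.
Qed.

Lemma quot_linearl n y : linear (fun x => quot_nprod x n y).
Proof.
move=> a x x'; rewrite -(qpi_repr x) -(qpi_repr x') -(qpi_repr y).
rewrite -linearP -!qpi_nprod -linearP; congr qpi; apply: val_inj => /=.
by rewrite nprodDl nprodZl.
Qed.
Lemma quot_linearr x n : linear (quot_nprod x n).
Proof.
move=> a y y'; rewrite -(qpi_repr x) -(qpi_repr y) -(qpi_repr y').
rewrite -linearP -!qpi_nprod -linearP; congr qpi; apply: val_inj => /=.
by rewrite linearP.
Qed.
Lemma quot_trunc x y : exists B : int, forall n, B <= n -> quot_nprod x n y = 0.
Proof.
have [B HB] := nprod_trunc (val (repr x)) (val (repr y)); exists B => n /HB H.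
rewrite -(linear0 qpi); congr qpi; exact: val_inj.
Qed.
Lemma quot_vac_nprod n x :
  quot_nprod (qpi (subva_vac S)) n x = if n == -1 then x else 0.
Proof.
rewrite -(qpi_repr x) -qpi_nprod -(linear0 qpi) -fun_if; congr qpi.
by apply: val_inj; rewrite val_nprod val_subva_vac vac_nprod; case: ifP.
Qed.
Lemma quot_nprod_vac x n : 0 <= n -> quot_nprod x n (qpi (subva_vac S)) = 0.
Proof.
move=> n0; rewrite -(qpi_repr x) -qpi_nprod -(linear0 qpi); congr qpi.
by apply: val_inj; rewrite val_nprod val_subva_vac nprod_vac.
Qed.
Lemma quot_nprod_vacN1 x : quot_nprod x (-1) (qpi (subva_vac S)) = x.
Proof.
rewrite -(qpi_repr x) -qpi_nprod; congr qpi.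
by apply: val_inj; rewrite val_nprod val_subva_vac nprod_vacN1.
Qed.

Lemma quot_borcherds x y z (m n k : int) :
  \sum_(i \in [set: nat])
    binz F m i *: quot_nprod (quot_nprod x (n + i%:Z) y) (m + k - i%:Z) z
  = \sum_(i \in [set: nat]) ((-1) ^+ i * binz F n i) *:
      (quot_nprod x (m + n - i%:Z) (quot_nprod y (k + i%:Z) z)
       - (-1) ^ n *: quot_nprod y (n + k - i%:Z) (quot_nprod x (m + i%:Z) z)).
Proof.
rewrite -(qpi_repr x) -(qpi_repr y) -(qpi_repr z).
set u := repr x; set v := repr y; set w := repr z.
have [B [B1 B2 B3]] : exists B : nat, [/\
    forall i, (B <= i)%N -> val u *_[n + i%:Z] val v = 0,
    forall i, (B <= i)%N -> val v *_[k + i%:Z] val w = 0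
  & forall i, (B <= i)%N -> val u *_[m + i%:Z] val w = 0].
  have tr (a b : V) (c : int) : exists B : nat, forall i, (B <= i)%N ->
      a *_[c + i%:Z] b = 0.
    have [B HB] := nprod_trunc a b; exists `|B - c|%N => i Bi; apply: HB.
    by rewrite -lerBlDl (le_trans (ler_norm _))// -abszE lez_nat.
  have [B1 H1] := tr (val u) (val v) n; have [B2 H2] := tr (val v) (val w) k.
  have [B3 H3] := tr (val u) (val w) m.
  exists (maxn B1 (maxn B2 B3)).
  by split=> i; rewrite !geq_max => /and3P[h1 h2 h3]; auto.
have := borcherds (val u) (val v) (val w) m n k.
rewrite (@fsum_natE _ _ B); last by move=> i /B1 ->; rewrite nprod0l scaler0.
rewrite (@fsum_natE _ _ B); last first.
  by move=> i iB; rewrite B2 // B3 // !(linear0, scaler0, subr0).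
pose L i : subva_type S :=
  binz F m i *: subva_nprod (subva_nprod u (n + i%:Z) v) (m + k - i%:Z) w.
pose R i : subva_type S := ((-1) ^+ i * binz F n i) *:
  (subva_nprod u (m + n - i%:Z) (subva_nprod v (k + i%:Z) w)
   - (-1) ^ n *: subva_nprod v (n + k - i%:Z) (subva_nprod u (m + i%:Z) w)).
have valL i : val (L i) =
    binz F m i *: ((val u *_[n + i%:Z] val v) *_[m + k - i%:Z] val w).
  by rewrite /L subva_valZ.
have valR i : val (R i) = ((-1) ^+ i * binz F n i) *:
    (val u *_[m + n - i%:Z] (val v *_[k + i%:Z] val w)
     - (-1) ^ n *: (val v *_[n + k - i%:Z] (val u *_[m + i%:Z] val w))).
  by rewrite /R subva_valZ subva_valB subva_valZ.
move=> E; have {}E : \sum_(i < B) L i = \sum_(i < B) R i.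
  apply/(@val_inj _ _ (subva_type S)); rewrite !subva_val_sum.
  under eq_bigr do rewrite valL; under [RHS]eq_bigr do rewrite valR; exact: E.
have qL i : binz F m i *: quot_nprod (quot_nprod (qpi u) (n + i%:Z) (qpi v))
      (m + k - i%:Z) (qpi w) = qpi (L i).
  by rewrite /L qpiZ !qpi_nprod.
have qR i : ((-1) ^+ i * binz F n i) *:
      (quot_nprod (qpi u) (m + n - i%:Z) (quot_nprod (qpi v) (k + i%:Z) (qpi w))
       - (-1) ^ n *: quot_nprod (qpi v) (n + k - i%:Z)
                       (quot_nprod (qpi u) (m + i%:Z) (qpi w))) = qpi (R i).
  by rewrite /R qpiZ qpiB qpiZ !qpi_nprod.
under eq_fsbigr do rewrite qL; under [RHS]eq_fsbigr do rewrite qR.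
rewrite !(@fsum_natE _ _ B); first by rewrite -!linear_sum E.
- move=> i iB; rewrite -(linear0 qpi); congr qpi; apply: val_inj.
  by rewrite valR B2 // B3 // !(linear0, scaler0, subr0).
- move=> i iB; rewrite -(linear0 qpi); congr qpi; apply: val_inj.
  by rewrite valL B1 // nprod0l scaler0.
Qed.

HB.instance Definition _ := isVertexAlgebra.Build F quotVA
  quot_linearl quot_linearr quot_trunc quot_vac_nprod quot_nprod_vac
  quot_nprod_vacN1 quot_borcherds.

End Quotient.

Section CommTheory.
Variables (F : numFieldType) (V : vertexAlgType F).
Implicit Types u v w : V.

Lemma binz0 m : binz F m 0 = 1.
Proof. by rewrite /binz big_ord0 fact0 divr1. Qed.

Lemma binz0S i : binz F 0 i.+1 = 0.
Proof. by rewrite /binz big_ord_recl subrr !mul0r. Qed.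

Lemma subspace_sum (P : set V) I (r : seq I) (E : I -> V) :
  subspace P -> (forall i, P (E i)) -> P (\sum_(i <- r) E i).
Proof.
move=> [P0 PL] PE; apply: big_ind => // x y Px Py.
by rewrite -[x]scale1r; apply: PL.
Qed.

Lemma nprod_assoc u v w (n k : int) :
  (u *_[n] v) *_[k] w = \sum_(i \in [set: nat]) ((-1) ^+ i * binz F n i) *:
    (u *_[n - i%:Z] (v *_[k + i%:Z] w)
     - (-1) ^ n *: (v *_[n + k - i%:Z] (u *_[i%:Z] w))).
Proof.
have := borcherds u v w 0 n k; rewrite (@fsum_natE _ _ 1); last first.
  by case=> // i _; rewrite binz0S scale0r.
rewrite big_ord1 binz0 scale1r addr0 add0r subr0 => ->.
by apply: eq_fsbigr => i _; rewrite !add0r.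
Qed.

Lemma nprod_commute u v w (m k : int) :
  (forall i : int, 0 <= i -> u *_[i] v = 0) ->
  u *_[m] (v *_[k] w) = v *_[k] (u *_[m] w).
Proof.
move=> uv0; have := borcherds u v w m 0 k.
rewrite (@fsum_natE _ _ 0); last first.
  by move=> i _; rewrite add0r uv0 // nprod0l scaler0.
rewrite big_ord0 (@fsum_natE _ _ 1); last first.
  by case=> // i _; rewrite binz0S mulr0 scale0r.
rewrite big_ord1 binz0 expr0 mulr1 expr0z !scale1r /= !(subr0, addr0, add0r).
by move=> /esym/eqP; rewrite subr_eq0 => /eqP.
Qed.

Lemma nprod_sym0 u v : (forall i : int, 0 <= i -> u *_[i] v = 0) ->
  forall i : int, 0 <= i -> v *_[i] u = 0.
Proof.
move=> uv0 i i0; rewrite -[u in _ *_[_] u]nprod_vacN1 -nprod_commute //.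
by rewrite nprod_vac // linear0.
Qed.

Lemma Comm_subva (A : set V) : is_subva (Comm A).
Proof.
split; first split.
- by move=> u _ m _; rewrite linear0.
- by move=> a v w Cv Cw u Au m m0; rewrite nprod_linearr Cv // Cw // scaler0 addr0.
- by move=> u _ m m0; rewrite nprod_vac.
- move=> v n w Cv Cw u Au m m0; rewrite nprod_commute; last exact: Cv.
  by rewrite Cw // linear0.
Qed.

Lemma Comm_generated (A : set V) : Comm (generated_subva A) = Comm A.
Proof.
apply/seteqP; split=> v Cv u.
  by move=> Au; apply: Cv => S _; apply.
move=> /(_ (Comm [set v])) Au; apply: nprod_sym0 => i i0.
have : Comm [set v] u.
  apply: Au; first exact: Comm_subva.
  by move=> x Ax _ -> m m0; apply: (nprod_sym0 _ m0) => j; apply: Cv.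
exact.
Qed.

End CommTheory.

Section NullQuotient.
Variables (F : numFieldType) (W : vertexAlgType F) (rho e : W) (c : F).

(* J = Comm(M(rho), W) and P = \sum_(j >= 1) rho(-j)J + (vac - e)(-1)J; below
   e is e^(N rho) and c is N. *)
Definition nullJ : set W := Comm (generated_subva [set rho]).

Definition nullP : set W :=
  [set x | exists (n : nat) (u : nat -> W) (w : W),
    [/\ forall j, nullJ (u j), nullJ w
      & x = \sum_(j < n) (rho *_[- (j.+1)%:Z] u j) + (vac - e) *_[-1] w]].

Hypothesis rho_rho : forall i : int, 0 <= i -> rho *_[i] rho = 0.
Hypothesis rho_e : forall i : int, 0 <= i -> rho *_[i] e = 0.
Hypothesis e_J : Comm nullJ e.
Hypothesis De : e *_[-2] vac = c *: (rho *_[-1] e).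

Lemma nullJ_subva : is_subva nullJ. Proof. exact: Comm_subva. Qed.

Lemma nullJE : nullJ = Comm [set rho]. Proof. exact: Comm_generated. Qed.

Let JM u n v : nullJ u -> nullJ v -> nullJ (u *_[n] v).
Proof. by have [_ _ H] := nullJ_subva; apply: H. Qed.

Let JL a u v : nullJ u -> nullJ v -> nullJ (a *: u + v).
Proof. by have [[_ H] _ _] := nullJ_subva; apply: H. Qed.

Let JD u v : nullJ u -> nullJ v -> nullJ (u + v).
Proof. by move=> Ju; rewrite -[u]scale1r; apply: JL. Qed.

Let JS I (r : seq I) (E : I -> W) :
  (forall i, nullJ (E i)) -> nullJ (\sum_(i <- r) E i).
Proof. by apply: subspace_sum; have [] := nullJ_subva. Qed.

Let J0 : nullJ 0. Proof. by have [[H _] _ _] := nullJ_subva. Qed.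

Let J1 : nullJ vac. Proof. by have [_ H _] := nullJ_subva. Qed.

Let Jrho : nullJ rho. Proof. by rewrite nullJE => _ -> . Qed.

Let Je : nullJ e. Proof. by rewrite nullJE => _ -> . Qed.

Let J1e : nullJ (vac - e).
Proof. by rewrite addrC -scaleN1r; apply: JL. Qed.

Let rho0 v i : nullJ v -> 0 <= i -> rho *_[i] v = 0.
Proof. by rewrite nullJE => Jv; apply: Jv. Qed.

Let rhoC v w n m : nullJ v -> v *_[n] (rho *_[m] w) = rho *_[m] (v *_[n] w).
Proof. by move=> Jv; rewrite -(@nprod_commute _ _ rho v)// => i; apply: rho0. Qed.

Let e0 v i : nullJ v -> 0 <= i -> e *_[i] v = 0.
Proof. by move=> Jv; apply: nprod_sym0 => j; apply: e_J. Qed.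

Let eC v w n m : nullJ v -> v *_[n] (e *_[m] w) = e *_[m] (v *_[n] w).
Proof. by move=> Jv; rewrite -(@nprod_commute _ _ e v)// => i; apply: e0. Qed.

Lemma nullP_subspace : subspace nullP.
Proof.
split.
  exists 0%N, (fun=> 0), 0; split=> //; by rewrite big_ord0 linear0 addr0.
move=> a x y [n [u [w [Ju Jw ->]]]] [n' [u' [w' [Ju' Jw' ->]]]].
pose U (j : nat) := a *: (if (j < n)%N then u j else 0)
                    + (if (j < n')%N then u' j else 0).
exists (maxn n n'), U, (a *: w + w'); split.
- by move=> j; rewrite /U; apply: JL; case: ifP.
- exact: JL.
rewrite (eq_bigr (fun j : 'I_(maxn n n') =>
    a *: (if (j < n)%N then rho *_[- (j.+1)%:Z] u j else 0)
    + (if (j < n')%N then rho *_[- (j.+1)%:Z] u' j else 0))); last first.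
  by move=> j _; rewrite /U nprod_linearr; do 2 case: ifP => _; rewrite ?linear0.
rewrite big_split /= -scaler_sumr -!big_mkcond /=.
rewrite (big_ord_widen _ (fun j => rho *_[- (j.+1)%:Z] u j) (leq_maxl n n')).
rewrite (big_ord_widen _ (fun j => rho *_[- (j.+1)%:Z] u' j) (leq_maxr n n')).
by rewrite nprod_linearr scalerDr addrACA.
Qed.

Let P_rho j u : nullJ u -> nullP (rho *_[- (j.+1)%:Z] u).
Proof.
move=> Ju; exists j.+1, (fun i => if i == j then u else 0), 0; split=> //.
  by move=> i; case: ifP.
rewrite linear0 addr0 (bigD1 ord_max) //= eqxx big1 ?addr0 // => i /negPf.
by rewrite -val_eqE /= => ->; rewrite linear0.
Qed.

Let P_e w : nullJ w -> nullP ((vac - e) *_[-1] w).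
Proof.
by move=> Jw; exists 0%N, (fun=> 0), w; split=> //; rewrite big_ord0 add0r.
Qed.

Let PZ a x : nullP x -> nullP (a *: x).
Proof.
have [P0 PL] := nullP_subspace.
by move=> Px; rewrite -[_ *: x]addr0; apply: PL.
Qed.

Let PD x y : nullP x -> nullP y -> nullP (x + y).
Proof.
have [P0 PL] := nullP_subspace.
by move=> Px; rewrite -[x]scale1r; apply: PL.
Qed.

Let P_eS j w : nullJ w -> nullP (e *_[- (j.+2)%:Z] w).
Proof.
move=> Jw.
have binN2 i : binz F (-2) i = (-1) ^+ i * i.+1%:R.
  rewrite /binz; elim: i => [|i IH].
    by rewrite big_ord0 fact0 divr1 expr0 mul1r.
  rewrite big_ord_recr /= factS natrM invfM [i.+1%:R^-1 * _]mulrC mulrACA IH.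
  have i0 : i.+1%:R != 0 :> F by rewrite pnatr_eq0.
  rewrite mulrACA mulfV // mulr1 exprS mulN1r mulNr -mulrN; congr (_ * _).
  by rewrite -opprD -natrD.
have E : (e *_[-2] vac) *_[- (j.+1)%:Z] w = j.+1%:R *: (e *_[- (j.+2)%:Z] w).
  rewrite nprod_assoc (@fsum_natE _ _ j.+1); last first.
    move=> i ji; rewrite [e *_[i%:Z] w]e0 // linear0 scaler0 subr0.
    rewrite vac_nprod ifN; last by lia.
    by rewrite linear0 scaler0.
  rewrite big_ord_recr big1 /=; last first.
    move=> i _; rewrite [e *_[i%:Z] w]e0 // linear0 scaler0 subr0.
    rewrite vac_nprod ifN; last by have := ltn_ord i; lia.
    by rewrite linear0 scaler0.
  rewrite add0r [e *_[j%:Z] w]e0 // linear0 scaler0 subr0 vac_nprod ifT; last by lia.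
  rewrite binN2 mulrA -expr2 sqrr_sign mul1r; congr (_ *: (_ *_[_] _)).
  by lia.
have -> : e *_[- (j.+2)%:Z] w
    = j.+1%:R^-1 *: ((e *_[-2] vac) *_[- (j.+1)%:Z] w).
  by rewrite E scalerA mulVf ?scale1r // pnatr_eq0.
apply: PZ; rewrite De nprodZl; apply: PZ; rewrite nprod_assoc.
apply: subspace_sum nullP_subspace _ => i; apply: PZ.
rewrite [rho *_[i%:Z] w]rho0 // linear0 scaler0 subr0.
rewrite (_ : -1 - i%:Z = - (i.+1)%:Z); last by lia.
by apply: P_rho; apply: JM.
Qed.

Lemma nullP_ideal : is_ideal nullJ nullP.
Proof.
split=> //.
- by move=> _ [n [u [w [Ju Jw ->]]]]; apply: JD; [apply: JS => i|]; apply: JM.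
- exact: nullP_subspace.
- move=> v k _ Jv [n [u [w [Ju Jw ->]]]]; rewrite nprodDr nprod_sumr.
  apply: PD; first apply: subspace_sum nullP_subspace _ => i.
    by rewrite rhoC //; apply/P_rho/JM.
  rewrite nprodBl vac_nprod eqxx nprodBr eC //.
  have -> : v *_[k] w - e *_[-1] (v *_[k] w) = (vac - e) *_[-1] (v *_[k] w).
    by rewrite nprodBl vac_nprod eqxx.
  exact/P_e/JM.
- move=> _ k v [n [u [w [Ju Jw ->]]]] Jv; rewrite [_ *_[k] v]nprodDl nprod_suml.
  apply: PD; first apply: subspace_sum nullP_subspace _ => j.
    rewrite nprod_assoc; apply: subspace_sum nullP_subspace _ => i; apply: PZ.
    rewrite [rho *_[i%:Z] v]rho0 // linear0 scaler0 subr0.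
    rewrite (_ : - (j.+1)%:Z - i%:Z = - (j + i).+1%:Z); last by lia.
    exact/P_rho/JM.
  rewrite nprod_assoc; apply: subspace_sum nullP_subspace _ => i; apply: PZ.
  rewrite [(vac - e) *_[i%:Z] v]nprodBl vac_nprod e0 //= subr0.
  rewrite linear0 scaler0 subr0; case: i => [|i].
    by rewrite subr0; apply/P_e/JM.
  rewrite nprodBl vac_nprod; case: eqP => [|_]; first by lia.
  rewrite sub0r -scaleN1r; apply: PZ.
  rewrite (_ : -1 - i.+1%:Z = - (i.+2)%:Z); last by lia.
  exact/P_eS/JM.
Qed.

End NullQuotient.

Section Spans.
Variables (F : numFieldType) (V : lmodType F).

Definition lspan (A : set V) : set V :=
  [set v | exists (n : nat) (c : 'I_n -> F) (x : 'I_n -> V),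
     (forall i, A (x i)) /\ v = \sum_i c i *: x i].

Definition is_basis (I : eqType) (D : set I) (b : I -> V) (S : set V) : Prop :=
  (forall (s : seq I) (c : I -> F), uniq s -> (forall i, i \in s -> D i) ->
     \sum_(i <- s) c i *: b i = 0 -> forall i, i \in s -> c i = 0)
  /\ lspan (b @` D) = S.

Lemma mem_lspan (A : set V) v : A v -> lspan A v.
Proof.
move=> Av; exists 1%N, (fun=> 1), (fun=> v); split=> //.
by rewrite big_ord1 scale1r.
Qed.

End Spans.

Section VertexOperatorAlgebras.
Variables (F : numFieldType) (V : vertexAlgType F).

Definition Lvir (omega : V) (n : int) (v : V) : V := omega *_[n + 1] v.

Definition wt_space (omega : V) (n : nat) : set V :=
  [set v | Lvir omega 0 v = n%:R *: v].

(* A vertex operator algebra of CFT type: V is the direct sum of the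
   finite-dimensional eigenspaces V_n, n >= 0, of L(0), and V_0 = F vac. *)
Record is_voa_cft (omega : V) : Prop := {
  voa_translation : forall v, Lvir omega (-1) v = v *_[-2] vac;
  voa_virasoro : exists c : F, forall (m n : int) v,
    Lvir omega m (Lvir omega n v) - Lvir omega n (Lvir omega m v)
    = (m - n)%:~R *: Lvir omega (m + n) v
      + (if m + n == 0 then ((m ^+ 3 - m)%:~R / 12%:R * c) *: v else 0);
  voa_grading : lspan [set v | exists n, wt_space omega n v] = [set: V];
  voa_finite_dim : forall n, exists s : seq V,
    wt_space omega n `<=` lspan [set` s];
  voa_wt0 : wt_space omega 0 = [set v | exists a : F, v = a *: vac];
  voa_vac_neq0 : (vac : V) != 0
}.

Definition V1_form (u v : V) : F := xget 0 [set a : F | u *_[1] v = a *: vac].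

(* Cartan subalgebra (nilpotent and self-normalizing) of the Lie algebra V_1
   with bracket [u, v] = u(0)v. *)
Record is_cartan (omega : V) (A : set V) : Prop := {
  cartan_subspace : subspace A;
  cartan_wt1 : A `<=` wt_space omega 1;
  cartan_bracket : forall u v, A u -> A v -> A (u *_[0] v);
  cartan_nilpotent : exists k : nat, forall (s : seq V) (v : V),
    size s = k -> (forall u, u \in s -> A u) -> A v ->
    foldr (fun u x => u *_[0] x) v s = 0;
  cartan_normalizer : forall v, wt_space omega 1 v ->
    (forall u, A u -> A (v *_[0] u)) -> A v
}.

End VertexOperatorAlgebras.

Section TensorProducts.
Variables (F : numFieldType) (V L T : vertexAlgType F).

Definition bilinear_map (X Y Z : lmodType F) (f : X -> Y -> Z) : Prop :=
  (forall y, linear (f^~ y)) /\ forall x, linear (f x).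

(* [t v w] is the pure tensor of v and w; the last field is the coefficientwise
   form of Y(v \otimes w, z) = Y(v, z) \otimes Y(w, z), a finite sum. *)
Record is_tensor_va (t : V -> L -> T) : Prop := {
  tensor_bilinear : bilinear_map t;
  tensor_lift : forall (X : lmodType F) (f : V -> L -> X), bilinear_map f ->
    exists g : T -> X, linear g /\ forall v w, g (t v w) = f v w;
  tensor_uniq : forall (X : lmodType F) (g g' : T -> X), linear g -> linear g' ->
    (forall v w, g (t v w) = g' (t v w)) -> g =1 g';
  tensor_vac : t vac vac = vac;
  tensor_nprod : forall v w v' w' (n : int), t v w *_[n] t v' w'
    = \sum_(i \in [set: int]) t (v *_[i] v') (w *_[n - 1 - i] w')
}.

End TensorProducts.

Section LatticeVertexAlgebras.
Variables (F : numFieldType) (d : nat).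
Local Notation lattice := 'rV[int]_d.

Definition gram_pair (G : 'M[int]_d) (a b : lattice) : int :=
  (a *m G *m b^T) 0 0.

Definition is_lattice_cocycle (G : 'M[int]_d) (eps : lattice -> lattice -> F) :=
  [/\ forall a b, eps a b != 0,
      forall a, eps a 0 = 1 /\ eps 0 a = 1,
      forall a b c, eps a b * eps (a + b) c = eps b c * eps a (b + c)
    & forall a b, eps a b = (-1) ^ gram_pair G a b * eps b a].

Variable W : vertexAlgType F.

Definition heis_vec (h : 'I_d -> W) (a : lattice) : W := \sum_i h i *~ a 0 i.

(* The coefficient of z^k in exp(\sum_(n >= 1) a(-n) z^n / n) w. *)
Definition exp_coef (a : W) (k : nat) (w : W) : W :=
  \sum_(l < k.+1) (l`!%:R : F)^-1 *:
    \sum_(s : l.-tuple 'I_k.+1 |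
          all (fun n : 'I_k.+1 => (0 < n)%N) s && (sumn (map val s) == k))
      foldr (fun (n : 'I_k.+1) x => (n%:R : F)^-1 *: (a *_[- (n : nat)%:Z] x)) w s.

(* [fock h s w] is h_i1(-n1-1) ... h_ik(-nk-1) w for s = (i1,n1) :: ... ; as
   these operators commute, sorted sequences s index the distinct monomials. *)
Definition fock (h : 'I_d -> W) (s : seq ('I_d * nat)) (w : W) : W :=
  foldr (fun p x => h p.1 *_[- (p.2.+1)%:Z] x) w s.

Definition fock_le : rel ('I_d * nat) :=
  fun p q => (p.2 < q.2)%N || ((p.2 == q.2) && (p.1 <= q.1)%N).

(* The subspace S of W is the lattice vertex algebra M(1) \otimes F_eps[Lambda]
   of the even lattice Lambda = Z^d with Gram matrix G, possibly degenerate: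
   h i is the i-th basis vector h_i(-1)1 of the Heisenberg part, e a is e^a,
   and Y(e^a,z)e^b =
     eps(a,b) z^<a,b> exp(\sum_(n >= 1) a(-n) z^n / n) e^(a+b). *)
Record is_lattice_va (G : 'M[int]_d) (h : 'I_d -> W) (e : lattice -> W)
    (S : set W) : Prop := {
  lattice_heis : forall a b (n : int), 0 <= n ->
    heis_vec h a *_[n] heis_vec h b
    = if n == 1 then (gram_pair G a b)%:~R *: vac else 0;
  lattice_heis_exp : forall a b (n : int), 0 <= n ->
    heis_vec h a *_[n] e b
    = if n == 0 then (gram_pair G a b)%:~R *: e b else 0;
  lattice_exp0 : e 0 = vac;
  lattice_exp : exists2 eps, is_lattice_cocycle G eps &
    forall a b,
      (forall k : nat, e a *_[- gram_pair G a b - 1 - k%:Z] e b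
         = eps a b *: exp_coef (heis_vec h a) k (e (a + b)))
      /\ (forall n : int, - gram_pair G a b <= n -> e a *_[n] e b = 0);
  lattice_basis :
    is_basis [set p : seq ('I_d * nat) * lattice | sorted fock_le p.1]
      (fun p => fock h p.1 (e p.2)) S
}.

End LatticeVertexAlgebras.

Section IsotropicQuotient.
Variables (F : numFieldType) (W : vertexAlgType F).

(* Comm(J, W) is V_(Z N rho) = \bigoplus_n M(rho) \otimes e^(n N rho), the
   vertex algebra of the rank one lattice Z N rho with zero form. *)
Definition Comm_is_null_lattice (rho : W) (N : int) (e : 'rV[int]_1 -> W) : Prop :=
  is_lattice_va (0 : 'M[int]_1) (fun=> rho *~ N) e (Comm (nullJ rho)).

Variables (rho : W) (N : int) (e : 'rV[int]_1 -> W).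
Hypothesis N0 : N != 0.
Hypothesis He : Comm_is_null_lattice rho N e.

Let gram0 (a b : 'rV[int]_1) : gram_pair (0 : 'M[int]_1) a b = 0.
Proof. by rewrite /gram_pair mulmx0 mul0mx mxE. Qed.

Let heis1 : heis_vec (fun _ : 'I_1 => rho *~ N) (const_mx 1) = (N%:~R : F) *: rho.
Proof. by rewrite /heis_vec big_ord1 mxE mulr1z scaler_int. Qed.

Let NF : (N%:~R : F) != 0. Proof. by rewrite intr_eq0. Qed.

Let rho_rho (i : int) : 0 <= i -> rho *_[i] rho = 0.
Proof.
move=> i0; have := lattice_heis He (const_mx 1) (const_mx 1) i0.
rewrite gram0 scale0r if_same heis1 nprodZl linearZZ => /eqP.
by rewrite !scaler_eq0 (negPf NF) => /eqP.
Qed.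

Let rho_e (i : int) : 0 <= i -> rho *_[i] e (const_mx 1) = 0.
Proof.
move=> i0; have := lattice_heis_exp He (const_mx 1) (const_mx 1) i0.
rewrite gram0 scale0r if_same heis1 nprodZl => /eqP.
by rewrite scaler_eq0 (negPf NF) => /eqP.
Qed.

Let e_Comm : Comm (nullJ rho) (e (const_mx 1)).
Proof.
have [_ <-] := lattice_basis He; apply: mem_lspan.
by exists ([::], const_mx 1).
Qed.

Let exp_coef1 (a w : W) : exp_coef a 1 w = a *_[-1] w.
Proof.
rewrite /exp_coef big_ord_recr big_ord1 /= [X in _ *: X + _]big1; last first.
  by move=> s; rewrite (tuple0 s).
rewrite scaler0 add0r invr1 scale1r (big_pred1 [tuple ord_max]) /=.
  by rewrite invr1 scale1r.
case=> -[|x [|? ?]] //= Hs; rewrite -val_eqE /= eqseq_cons andbT -val_eqE /=.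
by rewrite addn0; case: x Hs => -[|[|]].
Qed.

Let D_e : e (const_mx 1) *_[-2] vac = N%:~R *: (rho *_[-1] e (const_mx 1)).
Proof.
have [eps [_ eps0 _ _] /(_ (const_mx 1) 0) [/(_ 1%N) + _]] := lattice_exp He.
rewrite gram0 (lattice_exp0 He) => ->.
by rewrite (eps0 _).1 scale1r addr0 exp_coef1 heis1 nprodZl.
Qed.

Definition isotropic_subva : subva W := SubVA (nullJ_subva rho).
Definition isotropic_ideal : ideal isotropic_subva :=
  @Ideal F W isotropic_subva (nullP rho (e (const_mx 1)))
    (nullP_ideal rho_rho rho_e e_Comm D_e).
(* J/P; this is V^[alpha] when W = V \otimes V_Pi11 and rho = rho_elt alpha. *)
Definition isotropic_quotient : vertexAlgType F := quotVA isotropic_ideal.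

End IsotropicQuotient.

Section Neighbor.
Variables (F : numFieldType) (V L T : vertexAlgType F).

Definition gram_Pi11 : 'M[int]_2 := \matrix_(i, j) (if i == j then 0 else -1).

(* The element beta + a r + b q of V \otimes V_Pi11, where r = h 0, q = h 1. *)
Definition heis_elt (t : V -> L -> T) (h : 'I_2 -> L) (beta : V) (a b : F) : T :=
  t beta vac + t vac (a *: h 0 + b *: h 1).

Definition rho_elt (t : V -> L -> T) (h : 'I_2 -> L) (alpha : V) : T :=
  heis_elt t h alpha 1 (V1_form alpha alpha / 2%:R).

End Neighbor.

(* Main.v *)
(* With [rho' = (N alpha / K, 1, N / K)], the element
   [(K / N) rho' = (alpha, K / N, 1)] is the image of [rho = (alpha, 1, K / N)]
   under the swap of [r] and [q].  The swap is an isometry of [Pi_{1,1}], hence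
   lifts to an automorphism of [V \otimes V_Pi11] carrying [J] to [J'] and
   [V_{Z N rho}] to [V_{Z K rho'}].  It need not carry [e^{N rho}] to the chosen
   [e^{N' rho'}].  However, in [Comm(J')] the vector [e^{mu rho'}] is determined
   up to a scalar by [L(-1) x = mu rho'(-1) x], so that [N' = K] or [N' = - K]
   and [P'] is the ideal attached to [c e^{K rho'}] for some [c != 0]; the
   scalar is absorbed by a torus automorphism [s ^ r(0)], as [e^{K rho'}] has
   [r(0)]-charge [- N != 0]. *)
From HB Require Import structures.
Require Import Defs.
From mathcomp Require Import all_boot all_order all_algebra.
From mathcomp Require Import zify ring.
From mathcomp Require Import boolp classical_sets fsbigop reals.
From mathcomp.real_closed Require Import complex.
Import Order.TTheory GRing.Theory Num.Theory.
Local Open Scope classical_set_scope.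
Local Open Scope ring_scope.

Set Implicit Arguments.
Unset Strict Implicit.
Unset Printing Implicit Defensive.

(** What has to be normalised is only the exponential: [J] and the sum of the rho(-j)J depend on the
    line through rho alone, so the factor K / N is harmless there, whereas the term 1 - e^(N rho)
    sees every scalar. Such scalars are unavoidable. A lift of an isometry comes from the universal
    property, which compares two systems of generators with the same cocycle [eps]. The cocycle
    pulled back along the swap has the commutator of [eps], so their ratio is symmetric, hence the
    coboundary of some [u] on the free lattice, and the lift multiplies e^a by [u a], about which
    nothing more is known. The tensor product is likewise known only through its universal property,
    and the vector e^(N rho) only through its relations. Its image under the torus is therefore
    deduced from its r(0)-eigenvalue, not from a formula for it as a tensor. Solving s^(-N) = c is
    where the complex numbers enter. *)

Section LinearMaps.
Variables (F : numFieldType) (U V : lmodType F) (f : U -> V).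
Hypothesis Hf : linear f.

Let lf : {linear U -> V} := HB.pack f (GRing.isLinear.Build F U V *:%R f Hf).

Lemma lin0 : f 0 = 0. Proof. exact: (linear0 lf). Qed.
Lemma linD u v : f (u + v) = f u + f v. Proof. exact: (linearD lf). Qed.
Lemma linB u v : f (u - v) = f u - f v. Proof. exact: (linearB lf). Qed.
Lemma linZ a u : f (a *: u) = a *: f u. Proof. exact: (linearZZ lf). Qed.
Lemma linMz u (n : int) : f (u *~ n) = f u *~ n.
Proof. exact: (raddfMz lf). Qed.
Lemma lin_sum I (r : seq I) (P : pred I) (E : I -> U) :
  f (\sum_(i <- r | P i) E i) = \sum_(i <- r | P i) f (E i).
Proof. exact: (linear_sum lf). Qed.

End LinearMaps.

Arguments lin0 {F U V f}.
Arguments linD {F U V f}.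
Arguments linB {F U V f}.
Arguments linZ {F U V f}.
Arguments linMz {F U V f}.
Arguments lin_sum {F U V f} _ {I}.

(** * Linear maps prescribed on a basis *)

Section BasisExtension.
Variables (F : numFieldType) (U V : lmodType F) (I : eqType) (D : set I).
Variables (b : I -> U) (S : set U).
Hypothesis Hb : is_basis D b S.

Definition combo (X : lmodType F) (b : I -> X) (l : seq (F * I)) : X :=
  \sum_(p <- l) p.1 *: b p.2.

(** Lists may repeat an index, while independence in [is_basis] speaks of duplicate-free ones;
    collecting coefficients reconciles the two. *)
Lemma combo_undup (X : lmodType F) (x : I -> X) l :
  combo x l = \sum_(i <- undup (map snd l))
    (\sum_(p <- l | p.2 == i) p.1) *: x i.
Proof.
rewrite /combo; under [RHS]eq_bigr => i _ do rewrite scaler_suml.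
rewrite (exchange_big_dep predT) //= big_seq [RHS]big_seq.
apply: eq_bigr => p pl; rewrite -big_filter.
rewrite (_ : [seq i <- undup (map snd l) | p.2 == i] = [:: p.2]) ?big_seq1 //.
have /filter_pred1_uniq : uniq (undup (map snd l)) by exact: undup_uniq.
move=> /(_ p.2); rewrite mem_undup map_f // => /(_ isT) <-.
by apply: eq_filter => i; rewrite eq_sym.
Qed.

Lemma basis_repr v : S v ->
  exists2 l, (forall p, p \in l -> D p.2) & v = combo b l.
Proof.
case: Hb => _ <- [n [c [x [Hx ->]]]].
have /choice[y Hy] i : exists j, D j /\ b j = x i.
  by case: (Hx i) => j Dj E; exists j.
exists [seq (c i, y i) | i <- enum 'I_n].
  by move=> p /mapP[i _ ->]; case: (Hy i).
rewrite /combo big_map big_enum /=; apply: eq_bigr => i _.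
by case: (Hy i) => _ ->.
Qed.

Lemma combo_eq0 (f : I -> V) l : (forall p, p \in l -> D p.2) ->
  combo b l = 0 -> combo f l = 0.
Proof.
move=> lD; rewrite !combo_undup => l0; rewrite big_seq big1 // => i il.
case: Hb => /(_ _ _ (undup_uniq _) _ l0) H _.
rewrite H ?scale0r // => j; rewrite mem_undup => /mapP[p pl ->]; exact: lD.
Qed.

(** Independence kills the collected coefficient at every index with [w] nonzero. With [w] the
    eigenvalues of an operator diagonal in the basis, this confines a vector of its kernel to the
    indices of eigenvalue zero. *)
Lemma basis_coef0 (w : I -> F) l : (forall p, p \in l -> D p.2) ->
  \sum_(p <- l) (p.1 * w p.2) *: b p.2 = 0 ->
  combo b l = \sum_(p <- l | w p.2 == 0) p.1 *: b p.2.
Proof.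
move=> lD l0.
have E (u : I -> F) :
    \sum_(p <- l) (p.1 * u p.2) *: b p.2 = combo (fun i => u i *: b i) l.
  by apply: eq_bigr => p _; rewrite scalerA.
have coef0 i : i \in undup (map snd l) ->
    (\sum_(p <- l | p.2 == i) p.1) * w i = 0.
  move: l0; rewrite E combo_undup.
  under eq_bigr do rewrite scalerA.
  case: Hb => H _ /(H _ (fun i => _ * w i) (undup_uniq _)); apply => j.
  rewrite mem_undup => /mapP[p pl ->]; exact: lD.
rewrite [RHS]big_mkcond /=.
transitivity (combo (fun i => if w i == 0 then b i else 0) l); last first.
  by apply: eq_bigr => p _; case: ifP => //; rewrite scaler0.
rewrite !combo_undup big_seq [RHS]big_seq; apply: eq_bigr => i /coef0 /eqP.
by rewrite mulf_eq0; case: (w i == 0) => //; rewrite orbF => /eqP->; rewrite !scale0r.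
Qed.

Lemma basis_neq0 i : D i -> b i != 0.
Proof.
move=> Di; apply/eqP => bi0; case: Hb => /(_ [:: i] (fun=> 1)) H _.
have /eqP : 1 = 0 :> F; last by rewrite oner_eq0.
apply: (H _ _ _ i); rewrite ?mem_seq1 //; last by rewrite big_seq1 bi0 scaler0.
by move=> j; rewrite mem_seq1 => /eqP->.
Qed.

Lemma basis_ind (P : set U) : P 0 -> (forall a u v, P u -> P v -> P (a *: u + v)) ->
  (forall i, D i -> P (b i)) -> S `<=` P.
Proof.
move=> P0 PL Pb v /basis_repr[l lD ->]; rewrite /combo big_seq.
elim/big_ind: _ => [//|u w Pu Pw|p /lD /Pb Pp].
  by rewrite -[u]scale1r; apply: PL.
by rewrite -[_ *: _]addr0; apply: PL.
Qed.

End BasisExtension.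

Section LinearExtension.
Variables (F : numFieldType) (U V : lmodType F) (I : eqType) (D : set I).
Variables (b : I -> U) (f : I -> V).
Hypothesis Hb : is_basis D b [set: U].

Lemma basis_extend : exists2 g : U -> V, linear g & forall i, D i -> g (b i) = f i.
Proof.
have /choice[r Hr] v : exists l, (forall p, p \in l -> D p.2) /\ v = combo b l.
  by have [l lD vE] := basis_repr Hb (Logic.I : [set: U] v); exists l.
have uniq_combo l l' : (forall p, p \in l -> D p.2) ->
    (forall p, p \in l' -> D p.2) -> combo b l = combo b l' ->
    combo f l = combo f l'.
  move=> lD lD' E; apply/eqP; rewrite -subr_eq0; apply/eqP.
  have comboB (X : lmodType F) (x : I -> X) :
      combo x l - combo x l' = combo x (l ++ [seq (- p.1, p.2) | p <- l']).
    rewrite /combo big_cat big_map -sumrN; congr (_ + _).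
    by apply: eq_bigr => p _; rewrite scaleNr.
  rewrite comboB; apply: (combo_eq0 Hb); last by rewrite -comboB E subrr.
  by move=> p; rewrite mem_cat => /orP[/lD//|/mapP[q /lD' Dq ->]].
exists (fun v => combo f (r v)) => [a u v|i Di]; last first.
  rewrite -[RHS]scale1r -[RHS](big_seq1 +%R (1, i) (fun p => p.1 *: f p.2)).
  apply: uniq_combo; first exact: (Hr _).1.
    by move=> p; rewrite mem_seq1 => /eqP->.
  by rewrite -(Hr _).2 /combo big_seq1 scale1r.
have comboL (X : lmodType F) (x : I -> X) :
    a *: combo x (r u) + combo x (r v)
    = combo x ([seq (a * p.1, p.2) | p <- r u] ++ r v).
  rewrite /combo big_cat big_map scaler_sumr; congr (_ + _).
  by apply: eq_bigr => p _; rewrite scalerA.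
rewrite comboL; apply: uniq_combo.
- exact: (Hr _).1.
- move=> p; rewrite mem_cat => /orP[/mapP[q qu ->]|]; last exact: (Hr v).1.
  exact: (Hr u).1 qu.
- by rewrite -comboL -!(Hr _).2.
Qed.

End LinearExtension.

(** * Modes and morphisms *)

Section Modes.
Variables (F : numFieldType) (W : vertexAlgType F).
Implicit Types u v w : W.

Lemma subspaceZ (P : set W) a v : subspace P -> P v -> P (a *: v).
Proof. by case=> P0 PL Pv; rewrite -[_ *: _]addr0; apply: PL. Qed.

Lemma nprodZr u n a v : u *_[n] (a *: v) = a *: (u *_[n] v).
Proof. exact: linearZZ. Qed.

Lemma binz1 m : binz F m 1 = m%:~R.
Proof. by rewrite /binz big_ord1 subr0 divr1. Qed.

Lemma nprod_eventually0 u v (c : int) :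
  exists B : nat, forall i, (B <= i)%N -> u *_[c + i%:Z] v = 0.
Proof.
have [B HB] := nprod_trunc u v; exists `|B - c|%N => i Bi; apply: HB.
by rewrite -lerBlDl (le_trans (ler_norm _))// -abszE lez_nat.
Qed.

Lemma nprod_comm u v w (m k : int) B :
  (forall i : nat, (B <= i)%N -> u *_[i%:Z] v = 0) ->
  u *_[m] (v *_[k] w) = v *_[k] (u *_[m] w)
    + \sum_(i < B) binz F m i *: ((u *_[i%:Z] v) *_[m + k - i%:Z] w).
Proof.
move=> uvB; have := borcherds u v w m 0 k.
rewrite (@fsum_natE _ _ B); last first.
  by move=> i Bi; rewrite add0r uvB // nprod0l scaler0.
under eq_bigr do rewrite add0r; move=> ->.
rewrite (@fsum_natE _ _ 1); last first.
  by case=> // i _; rewrite binz0S mulr0 scale0r.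
rewrite big_ord1 binz0 expr0 mulr1 expr0z !scale1r /= !(subr0, addr0, add0r).
by rewrite addrCA subrr addr0.
Qed.

Lemma binz_nat (n i : nat) : binz F n i = 'C(n, i)%:R.
Proof.
have fi0 : i`!%:R != 0 :> F by rewrite pnatr_eq0 -lt0n fact_gt0.
apply: (mulIf fi0); rewrite /binz divfK // -natrM bin_ffact.
have [ni|iltn] := ltnP n i.
  by rewrite ffact_small // (bigD1 (Ordinal ni)) //= subrr mul0r.
rewrite ffact_prod natr_prod; apply: eq_bigr => j _.
by rewrite natrB // ltnW // (leq_trans _ iltn).
Qed.

(** This is [L(-1), u(n)] = - n u(n-1), with L(-1) v written [v *_[-2] vac]. In the commutator
    formula on [vac], terms with i < n - 1 are non-negative modes of [vac], terms with i > n have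
    zero binomial, and i = n, n - 1 remain. *)
Lemma nprod_trans u v (n : nat) :
  u *_[n%:Z] (v *_[-2] vac)
  = (u *_[n%:Z] v) *_[-2] vac + n%:R *: (u *_[n%:Z - 1] v).
Proof.
have [B nB HB] : exists2 B, (n < B)%N &
    forall i : nat, (B <= i)%N -> u *_[i%:Z] v = 0.
  have [B0 H0] := nprod_eventually0 u v 0; exists (maxn B0 n.+1).
    by rewrite leq_max ltnSn orbT.
  by move=> i; rewrite geq_max => /andP[/H0 + _]; rewrite add0r.
rewrite (nprod_comm vac n (-2) HB) nprod_vac // linear0 add0r.
rewrite (bigD1 (Ordinal nB)) //= binz_nat binn scale1r.
rewrite (_ : _ - _ = -2); last by lia.
congr (_ + _); case: n nB => [|n] nB.
  rewrite scale0r big1 // => -[[|i] iB] //= _.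
  by rewrite binz0S scale0r.
have nB' : (n < B)%N by apply: ltnW.
rewrite (bigD1 (Ordinal nB')) /=; last by rewrite -val_eqE /= neq_ltn ltnSn.
rewrite (_ : n.+1%:Z + -2 - n%:Z = -1); last by lia.
rewrite nprod_vacN1 (_ : n.+1%:Z - 1 = n%:Z); last by lia.
rewrite binz_nat binSn big1 ?addr0 // => i /andP[].
rewrite -!val_eqE /= => i1 i2; have [ilt|ni] := ltnP i n.
  by rewrite nprod_vac ?scaler0 //; lia.
by rewrite binz_nat bin_small ?scale0r //; lia.
Qed.

End Modes.

Section MorphismTheory.
Variables (F : numFieldType) (U V W : vertexAlgType F).

Lemma va_morphism_comp (f : U -> V) (g : V -> W) :
  va_morphism f -> va_morphism g -> va_morphism (g \o f).
Proof.
case=> fL f1 fM [gL g1 gM]; split => [a u v||u n v] /=.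
- by rewrite fL gL.
- by rewrite f1 g1.
- by rewrite fM gM.
Qed.

Definition intertwines (f : U -> V) (x : U) :=
  forall n y, f (x *_[n] y) = f x *_[n] f y.

Variables (f : U -> V) (fL : linear f).

Lemma intertwines_subspace : subspace [set x | intertwines f x].
Proof.
split=> [n y|a u v Hu Hv n y] /=; first by rewrite (lin0 fL) !nprod0l (lin0 fL).
by rewrite nprod_linearl !fL Hu Hv nprod_linearl.
Qed.

(** The associativity formula writes the modes of u(n)v through those of [u] and [v], so the
    morphism property need only be checked on generators. *)
Lemma intertwines_nprod u n v :
  intertwines f u -> intertwines f v -> intertwines f (u *_[n] v).
Proof.
move=> Hu Hv k w; rewrite Hu !nprod_assoc.
have [B1 H1] := nprod_eventually0 v w k.
have [B2 H2] := nprod_eventually0 u w 0.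
rewrite !(@fsum_natE _ _ (maxn B1 B2)) => [||i].
- rewrite (lin_sum fL); apply: eq_bigr => i _.
  by rewrite (linZ fL) (linB fL) (linZ fL) !Hu !Hv !Hu.
- move=> i; rewrite geq_max => /andP[/H1 E1 /H2]; rewrite add0r => E2.
  rewrite [f v *_[_] f w](_ : _ = 0); last by rewrite -Hv E1 (lin0 fL).
  rewrite [f u *_[i%:Z] f w](_ : _ = 0); last by rewrite -Hu E2 (lin0 fL).
  by rewrite !(linear0, scaler0, subr0).
- rewrite geq_max => /andP[/H1 E1 /H2]; rewrite add0r => E2.
  by rewrite E1 E2 !(linear0, scaler0, subr0).
Qed.

End MorphismTheory.

(** * Heisenberg and exponential modes *)

Section LatticeRelations.
Variables (F : numFieldType) (d : nat) (G : 'M[int]_d).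
Local Notation lattice := 'rV[int]_d.

(* The relations of [is_lattice_va] for a prescribed cocycle, without the basis
   condition. *)
Record lattice_relations (W : vertexAlgType F) (eps : lattice -> lattice -> F)
    (h : 'I_d -> W) (e : lattice -> W) : Prop := {
  rel_heis : forall a b (n : int), 0 <= n ->
    heis_vec h a *_[n] heis_vec h b
    = if n == 1 then (gram_pair G a b)%:~R *: vac else 0;
  rel_heis_exp : forall a b (n : int), 0 <= n ->
    heis_vec h a *_[n] e b
    = if n == 0 then (gram_pair G a b)%:~R *: e b else 0;
  rel_exp0 : e 0 = vac;
  rel_exp : forall a b,
      (forall k : nat, e a *_[- gram_pair G a b - 1 - k%:Z] e b
         = eps a b *: exp_coef (heis_vec h a) k (e (a + b)))
      /\ (forall n : int, - gram_pair G a b <= n -> e a *_[n] e b = 0)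
}.

Lemma lattice_va_relations (W : vertexAlgType F) (h : 'I_d -> W) e S : is_lattice_va G h e S ->
  exists2 eps, is_lattice_cocycle G eps & lattice_relations eps h e.
Proof.
by case=> H1 H2 H3 [eps Heps H4] _; exists eps.
Qed.

Section Relations.
Variables (W : vertexAlgType F) (eps : lattice -> lattice -> F).
Variables (h : 'I_d -> W) (e : lattice -> W).
Hypothesis HR : lattice_relations eps h e.

Let del i : lattice := delta_mx 0 i.

Lemma heis_vec_delta i : heis_vec h (del i) = h i.
Proof.
rewrite /heis_vec (bigD1 i) //= mxE !eqxx mulr1z big1 ?addr0 // => j ji.
by rewrite mxE (negPf ji) andbF mulr0z.
Qed.

Lemma heis_gen i j (n : int) : 0 <= n -> h i *_[n] h j
  = if n == 1 then (gram_pair G (del i) (del j))%:~R *: vac else 0.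
Proof.
move=> n0; rewrite -(heis_vec_delta i) -[in LHS](heis_vec_delta j).
by rewrite (rel_heis HR).
Qed.

Lemma heis_comm i j (m k : int) w :
  h i *_[m] (h j *_[k] w) = h j *_[k] (h i *_[m] w)
   + (if m + k == 0 then (m * gram_pair G (del i) (del j))%:~R else 0) *: w.
Proof.
rewrite (@nprod_comm _ _ _ _ w m k 2); last first.
  by move=> n n2; rewrite heis_gen // ifN //; lia.
rewrite !big_ord_recl big_ord0 /= addr0 !heis_gen //=.
rewrite nprod0l scaler0 add0r binz1 nprodZl vac_nprod scalerA -intrM.
have -> : (m + k - 1 == -1) = (m + k == 0) by apply/eqP/eqP; lia.
by rewrite addr0; case: ifP => _; rewrite ?scaler0 ?scale0r.
Qed.

Lemma heis_exp_comm i b (m k : int) w :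
  h i *_[m] (e b *_[k] w) = e b *_[k] (h i *_[m] w)
   + (gram_pair G (del i) b)%:~R *: (e b *_[m + k] w).
Proof.
rewrite (@nprod_comm _ _ _ _ w m k 1); last first.
  move=> n n1; rewrite -(heis_vec_delta i) (rel_heis_exp HR) //.
  by rewrite ifN //; lia.
rewrite big_ord1 binz0 scale1r subr0 -(heis_vec_delta i) (rel_heis_exp HR) //=.
by rewrite nprodZl.
Qed.

(** Creation operators commute, because the central term of [heis_comm] needs total mode zero. Hence
    [fock] depends only on the multiset of its factors, although the basis is indexed by sorted
    sequences. *)
Lemma fock_rem p s w : p \in s ->
  fock h s w = h p.1 *_[- (p.2.+1)%:Z] fock h (rem p s) w.
Proof.
elim: s => // q s IH; rewrite inE /= eq_sym; case: eqP => [-> //|_ /= ps].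
by rewrite (IH ps) heis_comm /= scale0r addr0.
Qed.

Lemma fock_perm s s' w : perm_eq s s' -> fock h s w = fock h s' w.
Proof.
elim: s s' => [s'|p s IH s' ss']; first by rewrite perm_sym => /perm_nilP->.
have ps' : p \in s' by rewrite -(perm_mem ss') mem_head.
rewrite (fock_rem w ps') /= (IH (rem p s')) //.
by rewrite -(perm_cons p) (perm_trans ss') // perm_to_rem.
Qed.

Lemma fock_sort s w : fock h (sort (@fock_le d) s) w = fock h s w.
Proof. by apply: fock_perm; rewrite perm_sort. Qed.

Lemma fock_le_total : total (@fock_le d).
Proof. by move=> [i m] [j n]; rewrite /fock_le /=; lia. Qed.

End Relations.
End LatticeRelations.

(** * The universal property of lattice vertex algebras *)

Section UniversalProperty.
Variables (F : numFieldType) (d : nat) (G : 'M[int]_d).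
Local Notation lattice := 'rV[int]_d.
Variables (U W : vertexAlgType F) (eps : lattice -> lattice -> F).

Lemma morph_exp_coef (f : U -> W) a k w : linear f -> intertwines f a ->
  f (exp_coef a k w) = exp_coef (f a) k (f w).
Proof.
move=> fL fa; rewrite /exp_coef (lin_sum fL); apply: eq_bigr => l _.
rewrite (linZ fL) (lin_sum fL); congr (_ *: _); apply: eq_bigr => s _.
by elim: (val s) => //= n s' <-; rewrite (linZ fL) fa.
Qed.

Lemma morph_heis_vec (f : U -> W) (h : 'I_d -> U) a : linear f ->
  f (heis_vec h a) = heis_vec (f \o h) a.
Proof.
by move=> fL; rewrite /heis_vec (lin_sum fL); apply: eq_bigr => i _; rewrite (linMz fL).
Qed.

Variables (h : 'I_d -> U) (e : lattice -> U) (h' : 'I_d -> W) (e' : lattice -> W).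
Hypothesis HR : lattice_relations G eps h e.
Hypothesis HR' : lattice_relations G eps h' e'.
Hypothesis Hb : is_basis [set p : seq ('I_d * nat) * lattice | sorted (@fock_le d) p.1]
      (fun p => fock h p.1 (e p.2)) [set: U].

Lemma fock_ind (P : set U) : P 0 -> (forall a u v, P u -> P v -> P (a *: u + v)) ->
  (forall s a, P (fock h s (e a))) -> forall v, P v.
Proof.
move=> P0 PL Pe v; apply: (basis_ind Hb P0 PL) => // p _; exact: Pe.
Qed.

(** Monomials are sent to monomials, so negative Heisenberg modes are intertwined by construction.
    The other modes of [h i], and those of [e a], are commuted through a monomial down to [e b],
    where the relations decide; [intertwines_nprod] does the rest. *)
Lemma lattice_va_hom : exists2 f : U -> W, va_morphism f &
  (forall i, f (h i) = h' i) /\ (forall a, f (e a) = e' a).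
Proof.
have [f fL f_sorted] := basis_extend (fun p => fock h' p.1 (e' p.2)) Hb.
have f_fock s a : f (fock h s (e a)) = fock h' s (e' a).
  rewrite -(fock_sort HR) -(fock_sort HR') (f_sorted (_, _)) //=.
  exact: (sort_sorted (@fock_le_total d)).
have fe a : f (e a) = e' a by exact: (f_fock [::] a).
have inter_span x x' : (forall n s a, f (x *_[n] fock h s (e a)) = x' *_[n] fock h' s (e' a)) ->
    forall n y, f (x *_[n] y) = x' *_[n] f y.
  move=> xx' n; apply: fock_ind => [|c u v Hu Hv|s a].
  - by rewrite linear0 !(lin0 fL) linear0.
  - by rewrite linearP !fL linearP Hu Hv.
  - by rewrite xx' f_fock.
have h_neg i m : forall y, f (h i *_[- m.+1%:Z] y) = h' i *_[- m.+1%:Z] f y.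
  apply: fock_ind => [|c u v Hu Hv|s a].
  - by rewrite linear0 !(lin0 fL) linear0.
  - by rewrite linearP !fL linearP Hu Hv.
  - by rewrite -[LHS]/(f (fock h ((i, m) :: s) (e a))) !f_fock.
have fh i : f (h i) = h' i.
  have := h_neg i 0%N vac; rewrite !nprod_vacN1 => ->.
  by rewrite -(rel_exp0 HR) fe (rel_exp0 HR') nprod_vacN1.
have h_all i n y : f (h i *_[n] y) = h' i *_[n] f y.
  apply: inter_span => {n y} n s a; have [n0|n0] := ltP n 0.
    have -> : n = - `|n|.-1.+1%:Z by lia.
    by rewrite h_neg f_fock.
  elim: s => [|[j m] s IH] /=.
    rewrite -(heis_vec_delta h i) -(heis_vec_delta h' i).
    rewrite (rel_heis_exp HR) // (rel_heis_exp HR') //.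
    by case: ifP; rewrite ?(linZ fL) ?(lin0 fL) ?fe.
  rewrite (heis_comm HR) (heis_comm HR') (linD fL) (linZ fL) h_neg IH.
  by rewrite f_fock.
have inter_h i : intertwines f (h i) by move=> n y; rewrite h_all fh.
have inter_vec a : intertwines f (heis_vec h a).
  have [I0 IL] := intertwines_subspace fL.
  apply: (subspace_sum (P := [set x | intertwines f x])) => // i.
  by rewrite -scaler_int -[_ *: _]addr0; apply: IL => //; exact: inter_h.
have f_vec a : f (heis_vec h a) = heis_vec h' a.
  by rewrite morph_heis_vec //; congr heis_vec; apply/funext => i /=.
have inter_e a : intertwines f (e a).
  move=> n y; rewrite fe; move: n y; apply: inter_span => n s b.
  (* Pulling out a creation operator produces a term with mode [n - m.+1] of [e a], so the induction
     runs over all modes at once. *)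
  elim: s n => [|[j m] s IH] n /=.
    have [lt_n|ge_n] := ltP n (- gram_pair G a b); last first.
      by rewrite (rel_exp HR a b).2 // (rel_exp HR' a b).2 // (lin0 fL).
    have -> : n = - gram_pair G a b - 1 - `|(n + gram_pair G a b + 1)%R|%N%:Z by lia.
    rewrite (rel_exp HR a b).1 (rel_exp HR' a b).1 (linZ fL).
    by rewrite morph_exp_coef // f_vec fe.
  have C (V : vertexAlgType F) (hV : 'I_d -> V) eV (w : V) :
      lattice_relations G eps hV eV ->
      eV a *_[n] (hV j *_[- m.+1%:Z] w) = hV j *_[- m.+1%:Z] (eV a *_[n] w)
        - (gram_pair G (delta_mx 0 j) a)%:~R *: (eV a *_[n - m.+1%:Z] w).
    by move=> HV; rewrite (heis_exp_comm HV) [- _ + n]addrC addrK.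
  by rewrite (C _ _ _ _ HR) (C _ _ _ _ HR') (linB fL) (linZ fL) inter_h fh !IH.
have inter_all x : intertwines f x.
  move: x; apply: (@fock_ind [set x | intertwines f x]).
  - by have [] := intertwines_subspace fL.
  - by have [] := intertwines_subspace fL.
  - move=> s a; elim: s => [|[i m] s IH] /=; first exact: inter_e.
    exact: intertwines_nprod.
exists f; last by split.
by split=> //; rewrite -(rel_exp0 HR) fe (rel_exp0 HR').
Qed.

End UniversalProperty.

Section LatticeEndomorphisms.
Variables (F : numFieldType) (d : nat) (G : 'M[int]_d).
Local Notation lattice := 'rV[int]_d.
Variables (U : vertexAlgType F) (h : 'I_d -> U) (e : lattice -> U).
Hypothesis HL : is_lattice_va G h e [set: U].

(** The uniqueness half of the universal property; it makes endomorphisms constructed separately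
    inverse to each other. *)
Lemma lattice_morph_id (f : U -> U) : va_morphism f ->
  (forall i, f (h i) = h i) -> (forall a, f (e a) = e a) -> f =1 id.
Proof.
case=> fL f1 fM fh fe; apply: (@fock_ind _ _ _ h e (lattice_basis HL) [set x | f x = x]).
- by rewrite /= (lin0 fL).
- by move=> a u v /= fu fv; rewrite fL fu fv.
- by move=> s a; elim: s => [|p s /= IH] /=; rewrite ?fe // fM fh IH.
Qed.

End LatticeEndomorphisms.

(** * Automorphisms of lattice vertex algebras *)

Section SymmetricCocycle.
Variables (F : numFieldType) (d : nat).
Local Notation lattice := 'rV[int]_d.
Variable c : lattice -> lattice -> F.
Hypothesis c_neq0 : forall a b, c a b != 0.
Hypothesis c0l : forall a, c 0 a = 1.
Hypothesis cA : forall a b g, c a b * c (a + b) g = c b g * c a (b + g).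
Hypothesis cC : forall a b, c a b = c b a.

(** The extension of the lattice by the multiplicative group of [F] with cocycle [c], written
    additively so that integer multiples and big sums apply to it. *)
Definition cocycle_ext : Type := ({x : F | x != 0} * lattice)%type.
HB.instance Definition _ := Choice.on cocycle_ext.

Definition ext_pair (x : F) (x0 : x != 0) (a : lattice) : cocycle_ext :=
  (exist _ x x0, a).

Lemma ext_add_subproof (p q : cocycle_ext) :
  val p.1 * val q.1 * c p.2 q.2 != 0.
Proof. by rewrite !mulf_neq0 ?(valP p.1) ?(valP q.1). Qed.

Lemma ext_opp_subproof (p : cocycle_ext) :
  (val p.1)^-1 * (c p.2 (- p.2))^-1 != 0.
Proof. by rewrite mulf_neq0 ?invr_eq0 ?(valP p.1). Qed.

Definition ext_add p q := ext_pair (ext_add_subproof p q) (p.2 + q.2).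
Definition ext_opp p := ext_pair (ext_opp_subproof p) (- p.2).
Definition ext_zero := ext_pair (oner_neq0 F) 0.

Lemma ext_eq (p q : cocycle_ext) :
  val p.1 = val q.1 -> p.2 = q.2 -> p = q.
Proof. by case: p q => [x a] [y b] /= E ->; congr (_, _); apply: val_inj. Qed.

Lemma ext_addA : associative ext_add.
Proof.
move=> p q r; apply: ext_eq; rewrite /= ?addrA //.
have := cA p.2 q.2 r.2.
set x := c _ _; set y := c _ _; set z := c _ _; set t := c _ _ => xy.
by rewrite -!mulrA [x * _]mulrCA xy.
Qed.

Lemma ext_addC : commutative ext_add.
Proof.
move=> p q; apply: ext_eq; rewrite /=; last exact: addrC.
by rewrite cC [val p.1 * _]mulrC.
Qed.

Lemma ext_add0 : left_id ext_zero ext_add.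
Proof. by move=> p; apply: ext_eq; rewrite /= ?add0r // c0l mul1r mulr1. Qed.

Lemma ext_addN : left_inverse ext_zero ext_opp ext_add.
Proof.
move=> p; apply: ext_eq; rewrite /= ?addNr // [c (- _) _]cC.
by rewrite mulrAC mulfVK // mulVf // (valP p.1).
Qed.

HB.instance Definition _ :=
  GRing.isZmodule.Build cocycle_ext ext_addA ext_addC ext_add0 ext_addN.

(* A symmetric cocycle defines an abelian extension of a free abelian group,
   which splits. *)
Lemma symmetric_cocycle_coboundary : exists2 u : lattice -> F,
  (forall a, u a != 0) & forall a b, u a * u b * c a b = u (a + b).
Proof.
(* [z] is the homomorphic section that lifts each basis vector with scalar 1; its scalar part is
   [u], and additivity of [z] is the coboundary equation. *)
pose g (i : 'I_d) : cocycle_ext := ext_pair (oner_neq0 F) (delta_mx 0 i).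
pose z (a : lattice) : cocycle_ext := \sum_i g i *~ a 0 i.
have zD a b : z (a + b) = z a + z b.
  by rewrite /z -big_split; apply: eq_bigr => i _; rewrite mxE mulrzDr.
have p2 : zmod_morphism (fun p : cocycle_ext => p.2) by [].
pose p2M : {additive cocycle_ext -> lattice} :=
  HB.pack (fun p : cocycle_ext => p.2) (GRing.isZmodMorphism.Build _ _ _ p2).
have z2 a : (z a).2 = a.
  rewrite -[LHS]/(p2M (z a)) raddf_sum [RHS]row_sum_delta.
  by apply: eq_bigr => i _; rewrite raddfMz /= -scaler_int intz.
exists (fun a => val (z a).1) => [a|a b]; first exact: (valP (z a).1).
by rewrite zD /= !z2.
Qed.

End SymmetricCocycle.

Section Relabelling.
Variables (F : numFieldType) (d : nat) (G : 'M[int]_d).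
Local Notation lattice := 'rV[int]_d.
Variable p : 'I_d -> 'I_d.
Hypothesis pK : involutive p.
Hypothesis Gp : forall i j, G (p i) (p j) = G i j.

Definition relabel (a : lattice) : lattice := \row_j a 0 (p j).

Lemma relabelK : involutive relabel.
Proof. by move=> a; apply/rowP => j; rewrite !mxE pK. Qed.

Lemma relabelD a b : relabel (a + b) = relabel a + relabel b.
Proof. by apply/rowP => j; rewrite !mxE. Qed.

Lemma relabel0 : relabel 0 = 0.
Proof. by apply/rowP => j; rewrite !mxE. Qed.

Lemma gram_pairE (a b : lattice) :
  gram_pair G a b = \sum_j (\sum_i a 0 i * G i j) * b 0 j.
Proof. by rewrite /gram_pair mxE; apply: eq_bigr => j _; rewrite !mxE. Qed.

Lemma gram_relabel a b : gram_pair G (relabel a) (relabel b) = gram_pair G a b.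
Proof.
rewrite !gram_pairE [RHS](reindex_inj (inv_inj pK)); apply: eq_bigr => j _.
rewrite mxE; congr (_ * _); rewrite [RHS](reindex_inj (inv_inj pK)).
by apply: eq_bigr => i _; rewrite mxE Gp.
Qed.

Lemma heis_vec_relabel (U : vertexAlgType F) (h : 'I_d -> U) a :
  heis_vec (h \o p) a = heis_vec h (relabel a).
Proof.
rewrite /heis_vec [RHS](reindex_inj (inv_inj pK)); apply: eq_bigr => i _.
by rewrite /= mxE pK.
Qed.

Lemma exp_coefZ (U : vertexAlgType F) (a : U) k c w :
  exp_coef a k (c *: w) = c *: exp_coef a k w.
Proof.
rewrite /exp_coef scaler_sumr; apply: eq_bigr => l _.
rewrite [RHS]scalerA mulrC -scalerA; congr (_ *: _); rewrite scaler_sumr.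
apply: eq_bigr => s _; elim: (val s) => //= n s' ->.
by rewrite linearZZ !scalerA mulrC.
Qed.

Variables (U : vertexAlgType F) (eps : lattice -> lattice -> F).
Variables (h : 'I_d -> U) (e : lattice -> U).
Hypothesis HR : lattice_relations G eps h e.

(** The equation on [u] absorbs the discrepancy between [eps] and its pullback, so the new
    generators obey the relations with [eps] itself and the universal property applies to them. *)
Lemma relabel_relations (u : lattice -> F) : u 0 = 1 ->
  (forall a b, u a * u b * eps (relabel a) (relabel b) = u (a + b) * eps a b) ->
  lattice_relations G eps (h \o p) (fun a => u a *: e (relabel a)).
Proof.
move=> u0 ueps; split.
- by move=> a b n n0; rewrite !heis_vec_relabel (rel_heis HR) // gram_relabel.
- move=> a b n n0; rewrite heis_vec_relabel nprodZr (rel_heis_exp HR) //.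
  by rewrite gram_relabel; case: ifP; rewrite ?scaler0 // !scalerA mulrC.
- by rewrite relabel0 u0 scale1r (rel_exp0 HR).
- move=> a b; have [] := rel_exp HR (relabel a) (relabel b).
  rewrite gram_relabel => E1 E2; split=> [k|n n_ge].
    rewrite nprodZl nprodZr E1 relabelD exp_coefZ heis_vec_relabel.
    by rewrite !scalerA ueps mulrC.
  by rewrite nprodZl nprodZr E2 // !scaler0.
Qed.

End Relabelling.

Definition va_inverse (F : numFieldType) (U V : vertexAlgType F)
    (f : U -> V) (g : V -> U) :=
  [/\ va_morphism f, va_morphism g, cancel f g & cancel g f].

Section LatticeAutomorphisms.
Variables (F : numFieldType) (d : nat) (G : 'M[int]_d).
Local Notation lattice := 'rV[int]_d.
Variables (U : vertexAlgType F) (h : 'I_d -> U) (e : lattice -> U).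
Hypothesis HL : is_lattice_va G h e [set: U].
Variable p : 'I_d -> 'I_d.
Hypothesis pK : involutive p.
Hypothesis Gp : forall i j, G (p i) (p j) = G i j.
Local Notation relabel := (relabel p).

Lemma relabel_aut eps (u : lattice -> F) : lattice_relations G eps h e ->
  (forall a, u a != 0) -> u 0 = 1 ->
  (forall a b, u a * u b * eps (relabel a) (relabel b) = u (a + b) * eps a b) ->
  exists f g, [/\ va_inverse f g, forall i, f (h i) = h (p i)
    & forall a, f (e a) = u a *: e (relabel a)].
Proof.
move=> HR u_neq0 u0 ueps; have Hb := lattice_basis HL.
have [f fM [fh fe]] := lattice_va_hom HR (relabel_relations pK Gp HR u0 ueps) Hb.
(* The inverse must undo [f (e (relabel a)) = u (relabel a) *: e a], which dictates its scalars. *)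
have u'0 : (u (relabel 0))^-1 = 1 by rewrite relabel0 u0 invr1.
have u'eps a b : (u (relabel a))^-1 * (u (relabel b))^-1
    * eps (relabel a) (relabel b) = (u (relabel (a + b)))^-1 * eps a b.
  have := ueps (relabel a) (relabel b); rewrite !relabelK // -relabelD => E.
  apply: (mulfI (mulf_neq0 (mulf_neq0 (u_neq0 (relabel a)) (u_neq0 (relabel b)))
    (u_neq0 (relabel (a + b))))).
  transitivity (u (relabel (a + b)) * eps (relabel a) (relabel b)).
    by field; rewrite !u_neq0.
  by rewrite -E; field; rewrite u_neq0.
have [g gM [gh ge]] := lattice_va_hom HR
  (relabel_relations (u := fun a => (u (relabel a))^-1) pK Gp HR u'0 u'eps) Hb.
have [fL _ _] := fM; have [gL _ _] := gM.
exists f, g; split=> //; split=> // x.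
- apply: (lattice_morph_id HL (va_morphism_comp fM gM)) => [i|a] /=.
    by rewrite fh gh /= pK.
  by rewrite fe (linZ gL) ge scalerA !relabelK // mulfV ?scale1r.
- apply: (lattice_morph_id HL (va_morphism_comp gM fM)) => [i|a] /=.
    by rewrite gh fh /= pK.
  by rewrite ge (linZ fL) fe scalerA !relabelK // mulVf ?scale1r.
Qed.

Lemma permutation_aut : exists f g, va_inverse f g /\ forall i, f (h i) = h (p i).
Proof.
have [eps [eps_neq0 eps1 epsA epsC] HR] := lattice_va_relations HL.
pose c a b := eps (relabel a) (relabel b) / eps a b.
have c_neq0 a b : c a b != 0 by rewrite mulf_neq0 ?invr_eq0.
have c0l a : c 0 a = 1.
  by rewrite /c relabel0 (eps1 _).2 (eps1 _).2 divr1.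
have cA a b g : c a b * c (a + b) g = c b g * c a (b + g).
  by rewrite /c !relabelD !mulf_div epsA [eps a b * _]epsA.
(* Exchanging the arguments multiplies numerator and denominator by the same sign, as [p] preserves
   the Gram matrix. *)
have cC a b : c a b = c b a.
  rewrite /c [eps (relabel a) _]epsC [eps a b]epsC gram_relabel // -mulf_div.
  by rewrite divff ?mul1r // expfz_eq0 oppr_eq0 oner_eq0 andbF.
have [u u_neq0 uc] := symmetric_cocycle_coboundary c_neq0 c0l cA cC.
have u0 : u 0 = 1.
  apply: (mulIf (u_neq0 0)); rewrite mul1r -[RHS]/(u 0) -[X in _ = u X]addr0 -uc.
  by rewrite c0l mulr1.
have ueps a b : u a * u b * eps (relabel a) (relabel b) = u (a + b) * eps a b.
  by rewrite -uc /c mulrA divfK.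
by have [f [g [? ? _]]] := relabel_aut HR u_neq0 u0 ueps; exists f, g.
Qed.

End LatticeAutomorphisms.

Lemma torus_aut (F : numFieldType) (d : nat) (G : 'M[int]_d)
    (U : vertexAlgType F) (h : 'I_d -> U) (e : 'rV[int]_d -> U)
    (HL : is_lattice_va G h e [set: U]) (chi : 'rV[int]_d -> F) :
  (forall a, chi a != 0) -> (forall a b, chi (a + b) = chi a * chi b) ->
  exists f g, [/\ va_inverse f g, forall i, f (h i) = h i
    & forall a, f (e a) = chi a *: e a].
Proof.
move=> chi_neq0 chiD.
have [eps _ HR] := lattice_va_relations HL.
have chi0 : chi 0 = 1.
  by apply: (mulIf (chi_neq0 0)); rewrite mul1r -chiD addr0.
have relabel_id a : relabel id a = a by apply/rowP => j; rewrite mxE.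
have ueps a b : chi a * chi b * eps (relabel id a) (relabel id b)
    = chi (a + b) * eps a b by rewrite !relabel_id chiD.
have [f [g [fg fh fe]]] :=
  relabel_aut HL (fun=> erefl) (fun _ _ => erefl) HR chi_neq0 chi0 ueps.
by exists f, g; split=> // a; rewrite fe relabel_id.
Qed.

(** * Tensor products *)

Section SubmodType.
Variables (F : numFieldType) (T : lmodType F) (Q : submodClosed T).

Definition submod_type := {x : T | x \in Q}.
HB.instance Definition _ := SubChoice.on submod_type.
HB.instance Definition _ := [SubChoice_isSubLmodule of submod_type by <:].

End SubmodType.

Lemma fsum_seq (M : nmodType) (I : choiceType) (E : I -> M) (l : seq I) :
  uniq l -> (forall i, i \notin l -> E i = 0) ->
  \sum_(i \in [set: I]) E i = \sum_(i <- l) E i.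
Proof.
move=> l_uniq El; rewrite (fsbig_seq _ _ l_uniq).
apply/esym; apply: fsbig_widen => //= i [_ /negP]; exact: El.
Qed.

Section Tensor.
Variables (F : numFieldType) (V L T : vertexAlgType F) (t : V -> L -> T).
Hypothesis Ht : is_tensor_va t.

Let tl w : linear (t^~ w). Proof. exact: (tensor_bilinear Ht).1. Qed.
Let tr v : linear (t v). Proof. exact: (tensor_bilinear Ht).2. Qed.

(** The tensor map lifts to the submodule cut out by [P]. Followed by the inclusion, the lift agrees
    with the identity on pure tensors, hence everywhere. *)
Lemma tensor_ind (P : set T) : P 0 -> (forall a u v, P u -> P v -> P (a *: u + v)) ->
  (forall v w, P (t v w)) -> forall x, P x.
Proof.
move=> P0 PL Pt x; pose p : {pred T} := fun x => `[< P x >].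
have pP : submod_closed p.
  by split=> [|a u v /asboolP Pu /asboolP Pv]; apply/asboolP => //; apply: PL.
pose Q : submodClosed T := HB.pack p (GRing.isSubmodClosed.Build F T p pP).
pose f v w : submod_type Q := exist (fun x => x \in Q) (t v w) (asboolT (Pt v w)).
have f_bilin : bilinear_map f.
  split=> [w a u v|v a u w]; apply: val_inj => /=; [exact: tl|exact: tr].
have [g [gL gt]] := tensor_lift Ht f_bilin.
have -> : x = val (g x); last exact/asboolP/(valP (g x)).
apply: (tensor_uniq Ht (g := id) (g' := val \o g)) => // [a u v|v w] /=.
  by rewrite gL.
by rewrite gt.
Qed.

(** Vanishing is recorded on the factors and not on their tensor, so that the same finite index set
    still serves after a morphism is applied to the second factor. *)
Lemma tensor_support (v : V) (w : L) (v' : V) (w' : L) (n : int) : exists2 l : seq int, uniq l &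
  forall i, i \notin l -> v *_[i] v' = 0 \/ w *_[n - 1 - i] w' = 0.
Proof.
have [B1 H1] := nprod_trunc v v'; have [B2 H2] := nprod_trunc w w'.
exists [seq B1 - 1 - k%:Z | k <- iota 0 `|(B1 + B2 - n + 1)%R|%N].
  by rewrite map_inj_uniq ?iota_uniq // => x y; lia.
move=> i il; have [Bi|iB] := leP B1 i; first by left; apply: H1.
have [Bi|iB'] := leP B2 (n - 1 - i); first by right; apply: H2.
case/negP: il; apply/mapP; exists `|(B1 - 1 - i)%R|%N; last by lia.
by rewrite mem_iota; lia.
Qed.

Lemma tensor_nprod_seq v w v' w' (n : int) (l : seq int) : uniq l ->
  (forall i, i \notin l -> v *_[i] v' = 0 \/ w *_[n - 1 - i] w' = 0) ->
  t v w *_[n] t v' w' = \sum_(i <- l) t (v *_[i] v') (w *_[n - 1 - i] w').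
Proof.
move=> l_uniq Hl; rewrite (tensor_nprod Ht); apply: fsum_seq => // i /Hl[]->.
  by rewrite (lin0 (tl _)).
by rewrite (lin0 (tr _)).
Qed.

Lemma tensor_nprodr w v' w' n : t vac w *_[n] t v' w' = t v' (w *_[n] w').
Proof.
rewrite (@tensor_nprod_seq _ _ _ _ _ [:: -1]) // => [|i].
  by rewrite big_seq1 vac_nprod (_ : n - 1 - -1 = n) //; lia.
by rewrite mem_seq1 => ni; left; rewrite vac_nprod ifN.
Qed.

Lemma tensor_morphism (f : L -> L) : va_morphism f ->
  exists2 g : T -> T, va_morphism g & forall v w, g (t v w) = t v (f w).
Proof.
case=> fL f1 fM.
have tf_bilin : bilinear_map (fun v w => t v (f w)).
  by split=> [w|v a u w]; [exact: tl|rewrite fL tr].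
have [g [gL gt]] := tensor_lift Ht tf_bilin; exists g => //; split=> //.
  by rewrite -(tensor_vac Ht) gt f1.
move=> x n; apply: tensor_ind => [|a u v Hu Hv|v' w'].
- by rewrite linear0 !(lin0 gL) linear0.
- by rewrite linearP !gL linearP Hu Hv.
move: x; apply: tensor_ind => [|a u v Hu Hv|v w].
- by rewrite nprod0l (lin0 gL) nprod0l.
- by rewrite nprod_linearl !gL nprod_linearl Hu Hv.
have [l l_uniq Hl] := tensor_support v w v' w' n.
rewrite (tensor_nprod_seq l_uniq Hl) (lin_sum gL) !gt.
rewrite (tensor_nprod_seq l_uniq); last first.
  by move=> i /Hl[->|E]; [left|right; rewrite -fM E (lin0 fL)].
by apply: eq_bigr => i _; rewrite gt fM.
Qed.

Lemma tensor_aut (f f' : L -> L) : va_inverse f f' ->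
  exists g g', [/\ va_inverse g g', forall v w, g (t v w) = t v (f w)
    & forall v w, g' (t v w) = t v (f' w)].
Proof.
case=> fM f'M fK f'K.
have [g gM gt] := tensor_morphism fM; have [g' g'M g't] := tensor_morphism f'M.
have [gL _ _] := gM; have [g'L _ _] := g'M.
exists g, g'; split=> //; split=> //.
  apply: tensor_ind => [|a u v Hu Hv|v w]; first by rewrite (lin0 gL) (lin0 g'L).
    by rewrite gL g'L Hu Hv.
  by rewrite gt g't fK.
apply: tensor_ind => [|a u v Hu Hv|v w]; first by rewrite (lin0 g'L) (lin0 gL).
  by rewrite g'L gL Hu Hv.
by rewrite g't gt f'K.
Qed.

End Tensor.

(* On vectors of integral charge, an automorphism acting on homogeneous
   generators through a power of [s] acts everywhere as expected: if [x] has
   charge [n], the operators [d - m] for the other charges [m] annihilate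
   [g x - s ^ n x], but they act invertibly on charge [n]. *)
Section Charge.
Variables (F : numFieldType) (T : lmodType F) (d g : T -> T) (s : F) (n : int).
Hypotheses (dL : linear d) (gL : linear g) (gd : forall x, g (d x) = d (g x)).

Let shift (m : int) (x : T) : T := d x - m%:~R *: x.

Let shiftL m : linear (shift m).
Proof.
move=> a u v; rewrite /shift dL scalerDr !scalerA [m%:~R * a]mulrC -!scalerA.
by rewrite opprD addrACA scalerBr.
Qed.

Let shiftC m m' x : shift m (shift m' x) = shift m' (shift m x).
Proof.
rewrite /shift !(linB dL) !(linZ dL) !scalerBr !scalerA [m%:~R * _]mulrC.
by rewrite !opprD !opprK addrACA.
Qed.

Let shifts (ms : seq int) (x : T) : T := foldr shift x ms.

Let shiftsL ms : linear (shifts ms).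
Proof. by elim: ms => //= m ms IH a u v /=; rewrite IH shiftL. Qed.

Let shifts_cat ms ms' x : shifts (ms ++ ms') x = shifts ms (shifts ms' x).
Proof. by rewrite /shifts foldr_cat. Qed.

Let shiftsC ms ms' x : shifts ms (shifts ms' x) = shifts ms' (shifts ms x).
Proof.
have H m ms1 y : shift m (shifts ms1 y) = shifts ms1 (shift m y).
  by elim: ms1 => //= m1 ms1 IH; rewrite shiftC IH.
by elim: ms => //= m ms ->.
Qed.

(** Stated for every [x], not only for those of charge [n], so that it is stable under linear
    combinations and can be proved on generators. *)
Definition charge_split (x : T) : Prop := exists2 ms : seq int, n \notin ms &
  shifts ms (g x - s ^ n *: x) = 0.

Lemma charge_split_gen m x : d x = m%:~R *: x -> g x = s ^ m *: x ->
  charge_split x.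
Proof.
move=> dx gx; have [mn|nm] := eqVneq m n.
  by exists [::]; rewrite //= gx mn subrr.
exists [:: m]; first by rewrite mem_seq1 eq_sym.
rewrite /= -[_ - _](_ : (s ^ m - s ^ n) *: x = _); last by rewrite gx scalerBl.
by rewrite (linZ (shiftL m)) /shift dx subrr scaler0.
Qed.

Lemma charge_split0 : charge_split 0.
Proof. by exists [::]; rewrite //= (lin0 gL) scaler0 subrr. Qed.

Lemma charge_splitP a u v :
  charge_split u -> charge_split v -> charge_split (a *: u + v).
Proof.
move=> [ms1 n1 E1] [ms2 n2 E2]; exists (ms1 ++ ms2).
  by rewrite mem_cat negb_or n1.
have -> : g (a *: u + v) - s ^ n *: (a *: u + v)
    = a *: (g u - s ^ n *: u) + (g v - s ^ n *: v).
  rewrite gL scalerDr !scalerA [s ^ n * a]mulrC -!scalerA scalerBr.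
  by rewrite opprD addrACA.
rewrite shiftsL !shifts_cat E2 shiftsC E1.
by rewrite !(lin0 (shiftsL _)) scaler0 addr0.
Qed.

Lemma charge_eigen x : charge_split x -> d x = n%:~R *: x -> g x = s ^ n *: x.
Proof.
move=> [ms nms E] dx; apply/eqP; rewrite -subr_eq0; apply/eqP.
set y := _ - _ in E *.
have dy : d y = n%:~R *: y.
  by rewrite /y (linB dL) (linZ dL) -gd dx (linZ gL) scalerBr !scalerA mulrC.
have : exists2 c : F, c != 0 & shifts ms y = c *: y.
  elim: ms nms {E} => [|m ms IH]; first by exists 1; rewrite ?oner_eq0 //= scale1r.
  rewrite inE negb_or => /andP[nm /IH[c c0 /= ->]].
  exists (c * (n - m)%:~R); first by rewrite mulf_neq0 // intr_eq0 subr_eq0.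
  by rewrite (linZ (shiftL m)) /shift dy -scalerBl -rmorphB scalerA.
case=> c c0; rewrite E => /esym/eqP; rewrite scaler_eq0 (negPf c0) => /eqP.
done.
Qed.

End Charge.

(** * Null lattices *)

Section ExpCoef.
Variables (F : numFieldType) (U : vertexAlgType F).

Lemma exp_coef0 (a w : U) : exp_coef a 0 w = w.
Proof.
rewrite /exp_coef big_ord1 /= invr1 scale1r (big_pred1 [tuple]) //= => s.
by rewrite (tuple0 s) /=; apply/esym/eqP.
Qed.

Lemma exp_coef1 (a w : U) : exp_coef a 1 w = a *_[-1] w.
Proof.
rewrite /exp_coef !big_ord_recr big_ord0 /= big1 => [|s]; last by rewrite tuple0.
rewrite scaler0 !add0r invr1 scale1r (big_pred1 [tuple ord_max]) /=.
  by rewrite invr1 scale1r.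
case/tupleP => i s; rewrite (tuple0 s); apply/idP/eqP => [|[->]] //=.
rewrite addn0 andbT => /andP[_ /eqP i1]; apply: val_inj => /=.
by congr [:: _]; apply: val_inj.
Qed.

End ExpCoef.

Section NullLattice.
Variables (F : numFieldType) (W : vertexAlgType F) (rho : W) (N : int).
Local Notation hh := (rho *~ N).
Local Notation hs := (fun _ : 'I_1 => hh).
Variables (r : W) (kappa : F).
Hypothesis r_hh : forall k : int, 0 <= k ->
  r *_[k] hh = if k == 1 then kappa *: vac else 0.

Let r_comm (m k : int) w : r *_[m] (hh *_[k] w)
  = hh *_[k] (r *_[m] w) + (if m + k == 0 then m%:~R * kappa else 0) *: w.
Proof.
rewrite (@nprod_comm _ _ _ _ w m k 2); last first.
  by move=> n n2; rewrite r_hh // ifN //; lia.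
rewrite !big_ord_recl big_ord0 /= addr0 !r_hh //=.
rewrite nprod0l scaler0 add0r binz1 nprodZl vac_nprod scalerA addr0.
have -> : (m + k - 1 == -1) = (m + k == 0) by apply/eqP/eqP; lia.
by case: ifP => _; rewrite ?scaler0 ?scale0r.
Qed.

(* Applying [r(k+1)] to the equation shows that [r(k+1) x = 0] implies
   [r(k) x = 0] for [k >= 1]; descend from the truncation bound. *)
Lemma translate_eigen x (mu : F) : x *_[-2] vac = mu *: (hh *_[-1] x) ->
  (forall k : nat, r *_[k.+1%:Z] x = 0) /\ r *_[0] x = (mu * kappa) *: x.
Proof.
move=> Dx.
have step (k : nat) : r *_[k.+1%:Z] x = 0 ->
    k.+1%:R *: (r *_[k%:Z] x) = (if k == 0%N then mu * kappa else 0) *: x.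
  move=> rx; have := nprod_trans r x k.+1.
  rewrite Dx nprodZr r_comm rx linear0 !nprod0l !add0r scalerA.
  have -> : k.+1%:Z - 1 = k%:Z by lia.
  have -> : (k%:Z == 0) = (k == 0%N) by [].
  by move=> <-; case: eqP => [->|]; rewrite ?mul1r ?mulr0.
have van k : r *_[k.+1%:Z] x = 0.
  have [B HB] := nprod_eventually0 r x 1.
  have [Bk|/ltnW kB] := leqP B k; first by rewrite -[RHS](HB _ Bk) intS.
  rewrite -(subKn kB); elim: (B - k)%N => [|j IH].
    by rewrite subn0 -[RHS](HB _ (leqnn _)) intS.
  have [Bj|jB] := leqP B j.
    by rewrite (_ : B - j.+1 = B - j)%N //; lia.
  have E : (B - j = (B - j.+1).+1)%N by lia.
  move: IH; rewrite E => /step /eqP; rewrite scale0r scaler_eq0 pnatr_eq0.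
  by move/eqP.
by split=> //; have /= := step 0%N (van 0%N); rewrite scale1r.
Qed.

Variable e : 'rV[int]_1 -> W.
Hypothesis He : Comm_is_null_lattice rho N e.

Let gram0 (a b : 'rV[int]_1) : gram_pair (0 : 'M[int]_1) a b = 0.
Proof. by rewrite /gram_pair mulmx0 mul0mx mxE. Qed.

Let vecE a : heis_vec hs a = hh *~ a 0 0.
Proof. by rewrite /heis_vec big_ord1. Qed.

(** As the form is zero, mode -2 on [vac] picks the coefficient k = 1 of the exponential, which is
    a(-1). *)
Lemma null_exp_translate a :
  e a *_[-2] vac = (a 0 0)%:~R *: (hh *_[-1] e a).
Proof.
have [eps [_ eps0 _ _] HR] := lattice_va_relations He.
have [/(_ 1%N) + _] := rel_exp HR a 0; rewrite gram0 (rel_exp0 HR) => ->.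
by rewrite (eps0 _).1 scale1r addr0 exp_coef1 vecE -scaler_int nprodZl.
Qed.

Lemma null_exp_mul a b : exists2 c : F, c != 0 & e a *_[-1] e b = c *: e (a + b).
Proof.
have [eps [eps_neq0 _ _ _] HR] := lattice_va_relations He; exists (eps a b) => //.
by have [/(_ 0%N) + _] := rel_exp HR a b; rewrite gram0 exp_coef0.
Qed.

Lemma null_exp_neq0 a : e a != 0.
Proof. by apply: (basis_neq0 (lattice_basis He) (i := ([::], a))). Qed.

Lemma null_exp_Comm a : Comm (nullJ rho) (e a).
Proof.
have [_ <-] := lattice_basis He; apply: mem_lspan.
by exists ([::], a).
Qed.

Let hh_comm (m k : int) w : hh *_[m] (hh *_[k] w) = hh *_[k] (hh *_[m] w).
Proof.
have [eps _ HR] := lattice_va_relations He.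
have := heis_comm HR ord0 ord0 m k w.
by rewrite gram0 mulr0 if_same scale0r addr0.
Qed.

Let wt (s : seq ('I_1 * nat)) : nat := sumn [seq q.2.+1 | q <- s].

(** Each summand counts the factors hh(-n-1), because [r(n+1), hh(-n-1)] = (n+1) kappa and the
    positive modes of [r] kill [e a]. The bound [B] replaces an infinite sum and must exceed every
    mode index that occurs. *)
Let euler (B : nat) (x : W) : W :=
  \sum_(n < B) hh *_[- n.+1%:Z] (r *_[n.+1%:Z] x).

Let euler_fock B s a : (forall q, q \in s -> (q.2 < B)%N) ->
  euler B (fock hs s (e a)) = ((wt s)%:R * kappa) *: fock hs s (e a).
Proof.
elim: s => [|[i m] s IH] sB /=.
  rewrite mul0r scale0r /euler big1 // => n _.
  by rewrite (translate_eigen (null_exp_translate a)).1 linear0.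
have mB : (m < B)%N by exact: (sB (i, m) (mem_head _ _)).
have {}IH := IH (fun q qs => sB q (mem_behead (s := (i, m) :: s) qs)).
rewrite /euler; under eq_bigr do rewrite r_comm nprodDr nprodZr hh_comm /=.
rewrite big_split /= -nprod_sumr -/(euler B _) IH nprodZr (bigD1 (Ordinal mB)) //=.
rewrite addrN eqxx big1 ?addr0 => [|n]; last first.
  rewrite -val_eqE /= => nm; rewrite ifN ?scale0r //.
  by apply: contra nm => /eqP; lia.
by rewrite -scalerDl natrD mulrDl addrC.
Qed.

Let charge_fock s a : r *_[0] fock hs s (e a)
  = ((a 0 0)%:~R * kappa) *: fock hs s (e a).
Proof.
elim: s => [|[i m] s IH] /=.
  by rewrite (translate_eigen (null_exp_translate a)).2.
by rewrite r_comm IH nprodZr /= scale0r addr0.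
Qed.

Hypothesis kappa0 : kappa != 0.

(* The Euler operator [euler] detects the polynomial degree, and [r(0)] the
   charge, of an element of the null lattice algebra. *)
Lemma translate_eigen_exp x mu : Comm (nullJ rho) x -> x != 0 ->
  x *_[-2] vac = mu *: (hh *_[-1] x) ->
  exists (n : int) (c : F), [/\ mu = n%:~R, c != 0 & x = c *: e (const_mx n)].
Proof.
move=> Cx x_neq0 Dx; have [r_pos r_0] := translate_eigen Dx.
have Hb := lattice_basis He; have [l lD xE] := basis_repr Hb Cx.
pose B := (\max_(p <- l) \max_(q <- p.2.1) q.2).+1.
have lB p : p \in l -> forall q, q \in p.2.1 -> (q.2 < B)%N.
  move=> pl q qp; rewrite ltnS; apply: (@leq_trans (\max_(q <- p.2.1) q.2)).
    exact: (leq_bigmax_seq (F := snd) q).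
  exact: (leq_bigmax_seq (F := fun p => \max_(q <- p.2.1) q.2) p).
(* The positive modes of [r] kill [x], hence so does [euler], and only monomials of degree zero,
   that is bare exponentials, remain. *)
pose l1 := [seq p <- l | (wt p.2.1)%:R * kappa == 0].
have xE1 : x = combo (fun p => fock hs p.1 (e p.2)) l1.
  rewrite /combo big_filter xE.
  apply: (basis_coef0 Hb (w := fun p => (wt p.1)%:R * kappa) lD).
  transitivity (euler B x); last first.
    by rewrite /euler big1 // => n _; rewrite r_pos linear0.
  rewrite xE /euler /combo.
  under [RHS]eq_bigr do rewrite !linear_sum /=.
  rewrite exchange_big /= big_seq [RHS]big_seq; apply: eq_bigr => p pl.
  under eq_bigr do rewrite !nprodZr.
  by rewrite -scaler_sumr -/(euler B _) euler_fock ?scalerA //; apply: lB.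
(* [x] is also killed by r(0) - mu kappa. The exponents left all equal [mu], so a single exponential
   remains and [mu] is an integer. *)
pose charge (p : seq ('I_1 * nat) * 'rV[int]_1) : F :=
  (p.2 0 0)%:~R * kappa - mu * kappa.
pose l2 := [seq p <- l1 | charge p.2 == 0].
have l1D p : p \in l1 -> sorted (@fock_le 1) p.2.1.
  by rewrite mem_filter => /andP[_ /lD].
have xE2 : x = combo (fun p => fock hs p.1 (e p.2)) l2.
  rewrite /combo big_filter xE1.
  apply: (basis_coef0 Hb (w := charge) l1D).
  transitivity (r *_[0] x - (mu * kappa) *: x); last by rewrite r_0 subrr.
  rewrite xE1 /combo linear_sum scaler_sumr -sumrB /=; apply: eq_bigr => p _.
  by rewrite nprodZr charge_fock !scalerA -scalerBl mulrBr; congr ((_ - _) *: _); ring.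
have l2P p : p \in l2 -> p.2.1 = [::] /\ (p.2.2 0 0)%:~R = mu.
  rewrite !mem_filter subr_eq0 (inj_eq (mulIf kappa0)) mulf_eq0 (negPf kappa0) orbF.
  move=> /and3P[/eqP-> wt0 _]; split=> //; move: wt0; rewrite pnatr_eq0.
  by case: p.2.1.
case: l2 l2P xE2 => [_ xE2|p0 l2 l2P xE2].
  by move: x_neq0; rewrite xE2 /combo big_nil eqxx.
have [_ mu0] := l2P _ (mem_head _ _); set n := p0.2.2 0 0 in mu0.
have xn : x = (\sum_(p <- p0 :: l2) p.1) *: e (const_mx n).
  rewrite xE2 scaler_suml /combo big_seq [RHS]big_seq; apply: eq_bigr => p /l2P.
  move=> [-> /=]; rewrite -mu0 => /intr_inj pn; congr (_ *: e _).
  by apply/rowP => i; rewrite mxE (ord1 i) pn.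
exists n, (\sum_(p <- p0 :: l2) p.1); split=> //.
by apply: contraNneq x_neq0 => c0; rewrite xn c0 scale0r.
Qed.

Hypothesis N0 : N != 0.

Lemma null_exp_nullJ a : nullJ rho (e a).
Proof.
rewrite nullJE => _ -> i i0; have := lattice_heis_exp He (const_mx 1) a i0.
have NF : N%:~R != 0 :> F by rewrite intr_eq0.
rewrite gram0 scale0r if_same vecE mxE mulr1z -scaler_int nprodZl => /eqP.
by rewrite scaler_eq0 (negPf NF) => /eqP.
Qed.

End NullLattice.

(** * Dependence of the ideal P on the exponential *)

Section NullQuotients.
Variables (F : numFieldType) (W : vertexAlgType F).
Implicit Types rho x f g : W.

Lemma nullJ_scale a rho : a != 0 -> nullJ (a *: rho) = nullJ rho.
Proof.
move=> a0; rewrite !nullJE; apply/seteqP; split=> v Hv _ -> m m0.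
  have := Hv _ erefl m m0; rewrite nprodZl => /eqP.
  by rewrite scaler_eq0 (negPf a0) => /eqP.
by rewrite nprodZl Hv ?scaler0.
Qed.

Lemma nullP_scale a rho f : a != 0 -> nullP (a *: rho) f `<=` nullP rho f.
Proof.
move=> a0 _ [n [u [w [Ju Jw ->]]]]; move: Ju Jw; rewrite nullJ_scale // => Ju Jw.
exists n, (fun j => a *: u j), w; split=> //.
  by move=> j; apply: subspaceZ (Ju j); have [] := nullJ_subva rho.
by congr (_ + _); apply: eq_bigr => j _; rewrite nprodZl nprodZr.
Qed.

(** If g f = 1, then (1 - f) w = (1 - g)(- f w), so mutually inverse exponentials give the same
    ideal. *)
Lemma nullP_unit rho f g : nullJ rho f -> Comm (nullJ rho) f ->
  Comm (nullJ rho) g -> g *_[-1] f = vac -> nullP rho f `<=` nullP rho g.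
Proof.
move=> Jf Cf Cg gf _ [n [u [w [Ju Jw ->]]]].
have [JS _ JM] := nullJ_subva rho.
exists n, u, ((-1) *: (f *_[-1] w)); split=> //.
  by apply: (subspaceZ _ JS); apply: JM.
(* Non-negative modes of [f] and [g] kill [w], so only the term i = 0 of the associativity formula
   survives. *)
have gfw : g *_[-1] (f *_[-1] w) = w.
  have := nprod_assoc g f w (-1) (-1); rewrite gf vac_nprod eqxx => E; rewrite [RHS]E.
  have z v (i : nat) : Comm (nullJ rho) v -> v *_[i%:Z] w = 0.
    by move=> Cv; apply: (nprod_sym0 _ (_ : 0 <= i%:Z)) => // j j0; apply: Cv.
  rewrite (@fsum_natE _ _ 1) => [|[//|i] _]; rewrite ?big_ord1.
    by rewrite z // linear0 scaler0 !subr0 /= binz0 mulr1 expr0 scale1r.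
  rewrite [g *_[_] w]z // (_ : -1 + i.+1%:Z = i%:Z); last by lia.
  by rewrite [f *_[i%:Z] w]z // !(linear0, scaler0, subr0).
congr (_ + _); rewrite nprodZr !nprodBl !vac_nprod eqxx gfw scaleN1r opprB.
by [].
Qed.

(** Each lattice description applies to the exponential of the other, so [N] and [N'] divide each
    other. If N' = - N, then [e'] gives a multiple of the exponential inverse to that of [e], and
    [nullP_unit] lets it be inverted. *)
Lemma null_lattice_unique rho r kappa N N' e e' :
  N != 0 -> N' != 0 -> Comm_is_null_lattice rho N e ->
  Comm_is_null_lattice rho N' e' -> kappa != 0 ->
  (forall k : int, 0 <= k -> r *_[k] rho = if k == 1 then kappa *: vac else 0) ->
  exists2 c : F, c != 0 &
    nullP rho (e' (const_mx 1)) = nullP rho (c *: e (const_mx 1)).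
Proof.
move=> N0 N'0 He He' kappa0 r_rho.
have ratio M M' eM eM' : M != 0 -> M' != 0 -> Comm_is_null_lattice rho M eM ->
    Comm_is_null_lattice rho M' eM' -> exists (n : int) (c : F),
    [/\ M' = n * M, c != 0 & eM' (const_mx 1) = c *: eM (const_mx n)].
  move=> M0 M'0 HM HM'.
  have MF0 : M%:~R != 0 :> F by rewrite intr_eq0.
  have r_rhoM (k : int) : 0 <= k ->
      r *_[k] (rho *~ M) = if k == 1 then (M%:~R * kappa) *: vac else 0.
    move=> k0; rewrite -scaler_int nprodZr r_rho //.
    by case: ifP => _; rewrite ?scaler0 // scalerA.
  have [||n [c [E c0 ->]]] := translate_eigen_exp (x := eM' (const_mx 1))
      (mu := M'%:~R / M%:~R) r_rhoM HM (mulf_neq0 MF0 kappa0) (null_exp_Comm HM' _).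
  - exact: null_exp_neq0 HM' _.
  - rewrite (null_exp_translate HM') mxE scale1r -!scaler_int !nprodZl scalerA.
    by rewrite divfK.
  exists n, c; split=> //; apply: (intr_inj (R := F)).
  by rewrite intrM -E divfK.
have [n [c [E c0 ec]]] := ratio N N' e e' N0 N'0 He He'.
have [m [_ [E' _ _]]] := ratio N' N e' e N'0 N0 He' He.
have /orP[/eqP n1|/eqP n1] : (n == 1) || (n == -1).
  have nm : n * m = 1.
    by apply: (mulIf N0); rewrite mul1r {2}E' E mulrCA mulrA.
  have : `|(n * m)%R|%N == 1%N by rewrite nm.
  by rewrite abszM muln_eq1 => /andP[/eqP n1 _]; lia.
  by exists c; rewrite // ec n1.
(* [k] is the factor in e^1 e^(-1) = k, so (c k)^-1 e^1 is the inverse of c e^(-1). *)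
have [k k0 ek] := null_exp_mul He (const_mx 1) (const_mx (-1)).
have k0' : (c * k)^-1 != 0 by rewrite invr_eq0 mulf_neq0.
exists (c * k)^-1 => //; rewrite ec n1.
have JZ a v : nullJ rho (a *: e v).
  apply: (subspaceZ _ _ (null_exp_nullJ He N0 _)).
  by have [] := nullJ_subva rho.
have CZ a v : Comm (nullJ rho) (a *: e v).
  apply: (subspaceZ _ _ (null_exp_Comm He _)).
  by have [] := Comm_subva (nullJ rho).
have ee1 : (c * k)^-1 *: e (const_mx 1) *_[-1] (c *: e (const_mx (-1))) = vac.
  rewrite nprodZl nprodZr ek !scalerA (_ : _ + _ = 0); last first.
    by apply/matrixP => i j; rewrite !mxE subrr.
  by rewrite (lattice_exp0 He) -mulrA mulVf ?scale1r ?mulf_neq0.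
have ee2 : (c *: e (const_mx (-1))) *_[-1] ((c * k)^-1 *: e (const_mx 1)) = vac.
  rewrite -ee1 -[X in _ *_[-1] X]nprod_vacN1 -[X in _ = _ *_[-1] X]nprod_vacN1.
  apply: nprod_commute => i i0; exact: (CZ _ _ _ (JZ _ _)).
apply/seteqP; split; exact: nullP_unit (JZ _ _) (CZ _ _) (CZ _ _) _.
Qed.

End NullQuotients.

(** * Transport along automorphisms *)

Section Transport.
Variables (F : numFieldType) (U W : vertexAlgType F) (phi : U -> W).
Hypothesis phiM : va_morphism phi.

Let phiL : linear phi. Proof. by case: phiM. Qed.
Let phi1 : phi vac = vac. Proof. by case: phiM. Qed.
Let phiN u n v : phi (u *_[n] v) = phi u *_[n] phi v.
Proof. by case: phiM. Qed.

Lemma morph_nullJ rho x : nullJ rho x -> nullJ (phi rho) (phi x).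
Proof. by rewrite !nullJE => Hx _ -> m m0; rewrite -phiN Hx // (lin0 phiL). Qed.

Lemma morph_nullP rho f x : nullP rho f x -> nullP (phi rho) (phi f) (phi x).
Proof.
case=> n [u [w [Ju Jw ->]]]; exists n, (phi \o u), (phi w).
split=> [j||] /=; do ?exact: morph_nullJ.
rewrite (linD phiL) (lin_sum phiL) phiN (linB phiL) phi1; congr (_ + _).
by apply: eq_bigr => j _; rewrite phiN.
Qed.

Lemma morph_fock d (h : 'I_d -> U) s w :
  phi (fock h s w) = fock (phi \o h) s (phi w).
Proof. by elim: s => //= p s <-; rewrite phiN. Qed.

End Transport.

(** The lattice data involve rho only through [rho *~ N] and the commutant. So [phi rho] may differ
    from [rho'] by a scalar, at the price of changing the integer. *)
Lemma null_lattice_transport (F : numFieldType) (U W : vertexAlgType F)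
    (phi : U -> W) (psi : W -> U) rho (N : int) e rho' (N' : int) :
  va_inverse phi psi -> Comm_is_null_lattice rho N e ->
  phi rho *~ N = rho' *~ N' -> nullJ (phi rho) = nullJ rho' ->
  Comm_is_null_lattice rho' N' (phi \o e).
Proof.
case=> phiM psiM phiK psiK [H1 H2 H3 [eps Heps H4] [Hfree Hspan]] rhoE JE.
have [phiL phi1 phiN] := phiM; have [psiL psi1 psiN] := psiM.
rewrite /Comm_is_null_lattice -rhoE.
have vecE a : heis_vec (fun _ : 'I_1 => phi rho *~ N) a
    = phi (heis_vec (fun _ : 'I_1 => rho *~ N) a).
  by rewrite morph_heis_vec //; congr heis_vec; apply/funext => i /=; rewrite (linMz phiL).
have fockE p : fock (fun _ : 'I_1 => phi rho *~ N) p.1 (phi (e p.2))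
    = phi (fock (fun _ : 'I_1 => rho *~ N) p.1 (e p.2)).
  rewrite morph_fock //; congr fock; apply/funext => i /=; exact/esym/(linMz phiL).
split=> /=.
- move=> a b n n0; rewrite !vecE -phiN H1 //.
  by case: ifP => _; rewrite ?(linZ phiL) ?phi1 ?(lin0 phiL).
- move=> a b n n0; rewrite !vecE -phiN H2 //.
  by case: ifP => _; rewrite ?(linZ phiL) ?(lin0 phiL).
- by rewrite H3.
- exists eps => // a b; have [E1 E2] := H4 a b; split=> [k|n nab].
    by rewrite -phiN E1 (linZ phiL) vecE morph_exp_coef //.
  by rewrite -phiN E2 ?(lin0 phiL).
split=> [s c s_uniq sD|].
  under eq_bigr do rewrite fockE -(linZ phiL).
  rewrite -(lin_sum phiL) => /(congr1 psi); rewrite phiK (lin0 psiL).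
  exact: Hfree.
apply/seteqP; split=> [y [n [c [x [Hx ->]]]]|y Cy].
  rewrite -JE -[X in Comm _ X]psiK (lin_sum psiL) => u Ju m m0.
  have Cx : Comm (nullJ rho) (psi (\sum_(i < n) c i *: x i)).
    rewrite -Hspan; exists n, c, (psi \o x); split=> [i|].
      by have [p Dp E] := Hx i; exists p; rewrite //= -E fockE phiK.
    by rewrite (lin_sum psiL); apply: eq_bigr => i _; rewrite (linZ psiL).
  rewrite -(lin_sum psiL) -[u]psiK -phiN Cx ?(lin0 phiL) //.
  rewrite -[rho]phiK; exact: (morph_nullJ psiM).
have : Comm (nullJ rho) (psi y).
  move=> u Ju m m0; rewrite -[u]phiK -psiN Cy ?(lin0 psiL) //.
  by rewrite -JE; apply: (morph_nullJ phiM).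
rewrite -Hspan => -[n [c [x [Hx yE]]]]; exists n, c, (phi \o x); split=> [i|].
  by have [p Dp E] := Hx i; exists p; rewrite //= -E fockE.
rewrite -[y]psiK yE (lin_sum phiL).
by apply: eq_bigr => i _; rewrite (linZ phiL).
Qed.

Lemma quotVA_isomorphic (F : numFieldType) (U W : vertexAlgType F)
    (S : subva U) (I : ideal S) (S' : subva W) (I' : ideal S')
    (phi : U -> W) (psi : W -> U) : va_inverse phi psi ->
  (forall x, subva_set S x -> subva_set S' (phi x)) ->
  (forall y, subva_set S' y -> subva_set S (psi y)) ->
  (forall x, ideal_set I x -> ideal_set I' (phi x)) ->
  (forall y, ideal_set I' y -> ideal_set I (psi y)) ->
  va_isomorphic (quotVA I) (quotVA I').
Proof.
have quot_map (A B : vertexAlgType F) (SA : subva A) (IA : ideal SA)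
    (SB : subva B) (IB : ideal SB) (f : A -> B) : va_morphism f ->
    (forall x, subva_set SA x -> subva_set SB (f x)) ->
    (forall x, ideal_set IA x -> ideal_set IB (f x)) ->
    exists2 g : quotVA IA -> quotVA IB, va_morphism g &
      forall u v, val v = f (val u) -> g (qpi IA u) = qpi IB v.
  case=> fL f1 fM fS fI.
  pose f0 (u : subva_type SA) := in_subva (fS _ (subva_typeP u)).
  pose g (q : quotVA IA) : quotVA IB := qpi IB (f0 (repr q)).
  have gE u v : val v = f (val u) -> g (qpi IA u) = qpi IB v.
    move=> vu; apply/qpiP; rewrite vu /= -(linB fL); apply: fI.
    by apply/qpiP; rewrite qpi_repr.
  have g0 u : g (qpi IA u) = qpi IB (f0 u) by exact: gE.
  exists g => //; split=> [a x y||x n y].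
  - rewrite -(qpi_repr x) -(qpi_repr y) -linearP.
    rewrite !g0 -linearP; congr qpi; apply: val_inj => /=.
    by rewrite fL.
  - by apply: gE; rewrite !val_subva_vac f1.
  - rewrite -(qpi_repr x) -(qpi_repr y) -[X in g X]qpi_nprod.
    rewrite !g0 -[RHS]qpi_nprod; congr qpi; apply: val_inj => /=.
    by rewrite fM.
move=> [phiM psiM phiK psiK] phiS psiS phiI psiI.
have [f fM fE] := quot_map _ _ _ I _ I' phi phiM phiS phiI.
have [g gM gE] := quot_map _ _ _ I' _ I psi psiM psiS psiI.
exists f; split=> //; exists g => x.
  rewrite -(qpi_repr x) (fE _ (in_subva (phiS _ (subva_typeP (repr x))))) //.
  by apply: gE; rewrite /= phiK.
rewrite -(qpi_repr x) (gE _ (in_subva (psiS _ (subva_typeP (repr x))))) //.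
by apply: fE; rewrite /= psiK.
Qed.

(** * The swap of r and q *)

Section SwapAutomorphism.
Variables (F : numFieldType) (V L T : vertexAlgType F) (t : V -> L -> T).
Hypothesis Ht : is_tensor_va t.
Variables (h : 'I_2 -> L) (eL : 'rV[int]_2 -> L).
Hypothesis HL : is_lattice_va gram_Pi11 h eL [set: L].

Let tl w : linear (t^~ w). Proof. exact: (tensor_bilinear Ht).1. Qed.
Let tr v : linear (t v). Proof. exact: (tensor_bilinear Ht).2. Qed.

Lemma gram_pair_delta d (G : 'M[int]_d) i j :
  gram_pair G (delta_mx 0 i) (delta_mx 0 j) = G i j.
Proof. by rewrite /gram_pair -rowE trmx_delta -colE !mxE. Qed.

Lemma heis_elt_swap : exists g g', va_inverse g g' /\
  forall beta a b, g (heis_elt t h beta a b) = heis_elt t h beta b a.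
Proof.
have gram_rev i j : gram_Pi11 (rev_ord i) (rev_ord j) = gram_Pi11 i j.
  by rewrite !mxE (inj_eq rev_ord_inj).
have [f [f' [ff' fh]]] := permutation_aut HL (@rev_ordK 2) gram_rev.
have [g [g' [gg' gt _]]] := tensor_aut Ht ff'; exists g, g'; split=> // beta a b.
have [[gL _ _] _ _ _] := gg'; have [[fL f1 _] _ _ _] := ff'.
rewrite /heis_elt (linD gL) !gt f1 (linD fL) !(linZ fL) !fh addrC.
have -> : rev_ord 0 = 1 :> 'I_2 by apply: val_inj.
have -> : rev_ord 1 = 0 :> 'I_2 by apply: val_inj.
by rewrite [b *: _ + _]addrC addrC.
Qed.

Lemma heis_elt_scale c beta a b :
  c *: heis_elt t h beta a b = heis_elt t h (c *: beta) (c * a) (c * b).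
Proof.
by rewrite /heis_elt scalerDr -(linZ (tl _)) -(linZ (tr _)) scalerDr !scalerA.
Qed.

Local Notation r := (t vac (h 0)).

Lemma r_heis_elt beta b (k : int) : 0 <= k ->
  r *_[k] heis_elt t h beta 1 b = if k == 1 then (- b) *: vac else 0.
Proof.
move=> k0; have [eps _ HR] := lattice_va_relations HL.
rewrite /heis_elt nprodDr !(tensor_nprodr Ht) nprod_vac // (lin0 (tr _)) add0r.
rewrite nprodDr !nprodZr !(heis_gen HR) // !gram_pair_delta !mxE /=.
case: ifP => _; last by rewrite !scaler0 addr0 (lin0 (tr _)).
rewrite scale0r scaler0 add0r scalerA mulrN1 (linZ (tr _)).
by rewrite (tensor_vac Ht).
Qed.

(** The map is the identity on [V] tensored with the torus element scaling e^a by s^<r,a>. The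
    eigenvector clause serves vectors that have a known r(0)-charge but no expression by pure
    tensors; [charge_eigen] reduces it to tensors with Fock monomials. *)
Lemma torus_eigen (s : F) : s != 0 -> exists g g', [/\ va_inverse g g',
  forall beta a b, g (heis_elt t h beta a b) = heis_elt t h beta a b
  & forall x (n : int), r *_[0] x = n%:~R *: x -> g x = s ^ n *: x].
Proof.
move=> s0; have [eps _ HR] := lattice_va_relations HL.
pose charge (a : 'rV[int]_2) := gram_pair gram_Pi11 (delta_mx 0 0) a.
have chargeD a b : charge (a + b) = charge a + charge b.
  by rewrite /charge /gram_pair linearD mulmxDr mxE.
have [||f [f' [ff' fh fe]]] := torus_aut HL (chi := fun a => s ^ charge a).
- by move=> a; rewrite expfz_neq0.
- by move=> a b; rewrite chargeD expfzDr.
have [g [g' [gg' gt _]]] := tensor_aut Ht ff'; exists g, g'.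
have [gM _ _ _] := gg'; have [gL _ gN] := gM; have [[fL f1 fN] _ _ _] := ff'.
split=> // [beta a b|x n].
  by rewrite /heis_elt (linD gL) !gt f1 (linD fL) !(linZ fL) !fh.
apply: charge_eigen => //.
- exact: nprod_linearr.
- by move=> y; rewrite gN gt fh.
move: x; apply: (tensor_ind Ht).
- exact: charge_split0.
- by move=> a u v; apply: charge_splitP => //; apply: nprod_linearr.
move=> v w; move: w v; apply: (fock_ind (lattice_basis HL)).
- by move=> v; rewrite (lin0 (tr _)); apply: charge_split0.
- move=> a u w Hu Hw v; rewrite tr; apply: charge_splitP => //.
  exact: nprod_linearr.
move=> m a v; apply: (@charge_split_gen _ _ _ _ _ _ _ (charge a)); first exact: nprod_linearr.
- rewrite (tensor_nprodr Ht) -(linZ (tr _)); congr (t v _).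
  elim: m => [|[i j] m IH] /=.
    by rewrite -(heis_vec_delta h) (rel_heis_exp HR).
  by rewrite (heis_comm HR) IH nprodZr /= scale0r addr0.
rewrite gt -(linZ (tr _)); congr (t v _).
elim: m => [|p m IH] /=; first by rewrite fe.
by rewrite fN fh IH nprodZr.
Qed.

End SwapAutomorphism.

(** * Comparison of the two quotients *)

Lemma V1_form_scale (F : numFieldType) (V : vertexAlgType F) (alpha : V) (a c : F) :
  (vac : V) != 0 -> V1_form alpha alpha = a -> a != 0 ->
  V1_form (c *: alpha) (c *: alpha) = c ^+ 2 * a.
Proof.
move=> vac0 + a0.
have uniq_coef (x y : F) : x *: (vac : V) = y *: vac -> x = y.
  by move/eqP; rewrite -subr_eq0 -scalerBl scaler_eq0 (negPf vac0) orbF subr_eq0 => /eqP.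
(* [V1_form] defaults to 0, so a nonzero value certifies that alpha(1) alpha really is that multiple
   of [vac]. *)
rewrite /V1_form; case: xgetP => [b _ /= ab <-|_ a00]; last by rewrite -a00 eqxx in a0.
case: xgetP => [y _ /= |none].
  by rewrite nprodZl nprodZr ab !scalerA => /uniq_coef <-; rewrite expr2 ?mulrA.
case: (none (c ^+ 2 * b)) => /=.
by rewrite nprodZl nprodZr ab !scalerA expr2 ?mulrA.
Qed.

Lemma isotropic_quotient_dual (F : numFieldType) (V L T : vertexAlgType F)
    (alpha : V) (h : 'I_2 -> L) (eL : 'rV[int]_2 -> L)
    (HL : is_lattice_va gram_Pi11 h eL [set: L])
    (t : V -> L -> T) (Ht : is_tensor_va t)
    (N : int) (N0 : N != 0) (e : 'rV[int]_1 -> T)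
    (He : Comm_is_null_lattice (rho_elt t h alpha) N e)
    (K : int) (K0 : K != 0) :
  (forall (c : F) (n : int), c != 0 -> n != 0 -> exists2 s, s != 0 & s ^ n = c) ->
  (vac : V) != 0 -> V1_form alpha alpha = (2 * K)%:~R / N%:~R ->
  let alpha' := (N%:~R / K%:~R : F) *: alpha in
  (exists (N' : int) (e' : 'rV[int]_1 -> T),
     N' != 0 /\ Comm_is_null_lattice (rho_elt t h alpha') N' e')
  /\ forall (N' : int) (N'0 : N' != 0) (e' : 'rV[int]_1 -> T)
       (He' : Comm_is_null_lattice (rho_elt t h alpha') N' e'),
     va_isomorphic (isotropic_quotient N'0 He') (isotropic_quotient N0 He).
Proof.
move=> roots vac0 norm_alpha alpha'.
have NF : N%:~R != 0 :> F by rewrite intr_eq0.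
have KF : K%:~R != 0 :> F by rewrite intr_eq0.
have F2 : 2%:~R != 0 :> F by rewrite intr_eq0.
pose rho := rho_elt t h alpha; pose rho' := rho_elt t h alpha'.
(* [b] is half the norm of alpha. As alpha' = b^-1 alpha, its half-norm is b^-2 b = b^-1. *)
pose b : F := K%:~R / N%:~R.
have b0 : b != 0 by rewrite mulf_neq0 ?invr_eq0.
have rhoE : rho = heis_elt t h alpha 1 b.
  by rewrite /rho /rho_elt norm_alpha; congr heis_elt; rewrite intrM /b; field; rewrite NF.
have rho'E : rho' = heis_elt t h alpha' 1 b^-1.
  rewrite /rho' /rho_elt (V1_form_scale _ vac0 norm_alpha) ?mulf_neq0 ?invr_eq0 ?intr_eq0 //.
    by congr heis_elt; rewrite intrM /b; field; rewrite NF KF.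
  by rewrite mulf_neq0.
have [g [g' [gg' g_swap]]] := heis_elt_swap Ht HL.
have g_rho : g rho = b *: rho'.
  rewrite rhoE g_swap rho'E heis_elt_scale // mulr1 mulfV // scalerA.
  by rewrite /b -[K%:~R / _]invf_div mulVf ?scale1r // mulf_neq0 ?invr_eq0.
have He_g : Comm_is_null_lattice rho' K (g \o e).
  (* Since b N = K, the multiple of [rho'] that generates the image lattice is the K-th. *)
  apply: (null_lattice_transport gg' He).
    by rewrite -/rho g_rho -!scaler_int scalerA mulrC divfK.
  by rewrite -/rho g_rho nullJ_scale.
split; first by exists K, (g \o e).
move=> N' N'0 e' He'.
pose r := t vac (h 0).
have r_rho' (k : int) : 0 <= k ->
    r *_[k] rho' = if k == 1 then (- b^-1) *: vac else 0.
  by move=> k0; rewrite rho'E (r_heis_elt Ht HL).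
have [|c c0 PE] := null_lattice_unique K0 N'0 He_g He' _ r_rho'.
  by rewrite oppr_eq0 invr_eq0.
(* The exponent is K <r, rho'> = - K / b = - N. *)
have [|s s0 sN] := roots c (- N) c0; first by rewrite oppr_eq0.
have [x [x' [xx' x_heis x_eigen]]] := torus_eigen Ht HL s0.
have x_e : x (g (e (const_mx 1))) = c *: g (e (const_mx 1)).
  rewrite -sN; apply: x_eigen.
  have r_hh (k : int) : 0 <= k -> r *_[k] (rho' *~ K)
      = if k == 1 then (- N%:~R) *: vac else 0.
    move=> k0; rewrite -scaler_int nprodZr r_rho' //.
    case: ifP => _; rewrite ?scaler0 // scalerA; congr (_ *: _).
    by rewrite /b; field; rewrite NF KF.
  have [|_ ->] := translate_eigen (x := g (e (const_mx 1))) (mu := 1) r_hh.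
    by rewrite (null_exp_translate He_g) mxE.
  by rewrite mul1r rmorphN.
have [xM x'M xK x'K] := xx'; have [gM g'M gK g'K] := gg'.
have [xL _ _] := xM; have [x'L _ _] := x'M; have [g'L _ _] := g'M.
pose phi := x \o g; pose psi := g' \o x'.
have phi_inv : va_inverse psi phi.
  split; [exact: va_morphism_comp|exact: va_morphism_comp| |].
    by move=> y; rewrite /phi /psi /= g'K x'K.
  by move=> y; rewrite /phi /psi /= xK gK.
(* The torus fixes [rho'], which lies in the Heisenberg part, so it corrects the exponential without
   disturbing this equation. *)
have phi_rho : phi rho = b *: rho'.
  by rewrite /phi /= g_rho (linZ xL) rho'E x_heis.
have phi_e : phi (e (const_mx 1)) = c *: g (e (const_mx 1)) by [].
have psi_rho' : psi rho' = b^-1 *: rho.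
  have [_ _ psiK phiK] := phi_inv; have [psiM _ _ _] := phi_inv.
  have [psiL _ _] := psiM.
  apply: (scalerI b0); rewrite scalerA mulfV // scale1r -(linZ psiL).
  by rewrite -phi_rho phiK.
have psi_e : psi (c *: g (e (const_mx 1))) = e (const_mx 1).
  by rewrite -phi_e; have [_ _ _ ->] := phi_inv.
have [psiM phiM _ _] := phi_inv.
apply: (quotVA_isomorphic phi_inv) => y /=.
- move=> /(morph_nullJ psiM); rewrite psi_rho' nullJ_scale //.
  by rewrite invr_eq0.
- by move=> /(morph_nullJ phiM); rewrite phi_rho nullJ_scale.
- rewrite -/rho' PE => /(morph_nullP psiM); rewrite psi_rho' psi_e.
  by apply: nullP_scale; rewrite invr_eq0.
- move=> /(morph_nullP phiM); rewrite phi_rho phi_e -/rho' PE.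
  exact: nullP_scale.
Qed.

(** To cover negative exponents, the |n|-th root of c^(sgn n) is taken; then s^n = (s^|n|)^(sgn n) =
    c. *)
Lemma complex_int_root (R : realType) (c : R[i]) (n : int) :
  c != 0 -> n != 0 -> exists2 s, s != 0 & s ^ n = c.
Proof.
move=> c0 n0; have n_gt0 : (0 < `|n|)%N by rewrite absz_gt0.
pose c' := c ^ sgz n; have c'0 : c' != 0 by rewrite expfz_neq0.
have sE : (`|n|%N.-root c') ^+ `|n|%N = c' by rewrite rootCK.
exists (`|n|%N.-root c').
  by apply: contraNneq c'0 => s0; rewrite -sE s0 expr0n eqn0Ngt n_gt0.
set s := _.-root _ in sE *; have -> : s ^ n = (s ^+ `|n|%N) ^ sgz n.
  by rewrite -[s ^+ _]/(s ^ `|n|%N%:Z) exprz_exp mulrC -intEsg.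
by rewrite sE /c' exprz_exp mulz_sg n0 expr1z.
Qed.

Unset Implicit Arguments.
Set Strict Implicit.
Set Printing Implicit Defensive.
Theorem lemma3p14 (R : realType) (V L T : vertexAlgType R[i])
    (omega : V) (V_cft : is_voa_cft omega)
    (V1_neq0 : exists2 v : V, wt_space omega 1 v & v != 0)
    (A H : set V) (A_cartan : is_cartan omega A)
    (H_subspace : subspace H) (H_A : H `<=` A)
    (alpha : V) (alpha_H : H alpha)
    (* L = V_Pi11, with r = h 0, q = h 1, and T = V \otimes L *)
    (h : 'I_2 -> L) (eL : 'rV[int]_2 -> L)
    (L_Pi11 : is_lattice_va gram_Pi11 h eL [set: L])
    (t : V -> L -> T) (T_tensor : is_tensor_va t)
    (N : int) (N_neq0 : N != 0) (e : 'rV[int]_1 -> T)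
    (Comm_J : Comm_is_null_lattice (rho_elt t h alpha) N e)
    (K : int) (K_neq0 : K != 0)
    (alpha_norm : V1_form alpha alpha = (2 * K)%:~R / N%:~R) :
  let alpha' := ((N%:~R / K%:~R : R[i]) *: alpha) in
  (exists (N' : int) (e' : 'rV[int]_1 -> T),
     N' != 0 /\ Comm_is_null_lattice (rho_elt t h alpha') N' e')
  /\ forall (N' : int) (N'_neq0 : N' != 0) (e' : 'rV[int]_1 -> T)
       (Comm_J' : Comm_is_null_lattice (rho_elt t h alpha') N' e'),
     va_isomorphic (isotropic_quotient N'_neq0 Comm_J')
                   (isotropic_quotient N_neq0 Comm_J).
Proof.
apply: (isotropic_quotient_dual L_Pi11 T_tensor) => //.
- exact: complex_int_root.
- exact: voa_vac_neq0 V_cft.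
Qed.
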